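(* Let $G$ be an infinite, locally finite graph on a countable vertex set $\mathbb{V}$ and let $\Gamma$ be a group acting quasi-transitively on $\mathbb{V}$ by automorphisms of $G$. Let $S$ be a totally ordered discrete (countable) spin space. (1) Suppose that $S$ has a maximal element and let $\rho$ be a monotone $\Gamma$-invariant irreducible upwards specification. If $\mu^+$ is a probability measure, then it is $\Gamma$-fiid. (2) Suppose that $S$ is finite and let $\rho$ be a monotone $\Gamma$-invariant irreducible upwards-downwards specification. Then $\mu^+$ is $\Gamma$-fiid with a coding (from an i.i.d. process) whose coding radius satisfies $$\Pr(R_v>r)\le(|S|-1)\cdot\big\|\rho^{\boldsymbol{+}}_{\mathbb{V}_{v,r}}(\sigma_v\in\cdot)-\rho^{\boldsymbol{-}}_{\mathbb{V}_{v,r}}(\sigma_v\in\cdot)\big\|_{TV}\qquad\text{for all }v\in\mathbb{V}\text{ and }r\ge0.$$ In particular, if $\mu^+=\mu^-$ then $\mu^+$ is $\Gamma$-ffiid.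
   Context: **Specifications.** $S$ is totally ordered with maximal element $+$ (and, where relevant, minimal element $-$). Put $\Omega:=S^{\mathbb{V}}$ with the product partial order, $\boldsymbol{+}$ (resp. $\boldsymbol{-}$) the constant maximal (resp. minimal) configuration, $\Omega_V^\tau:=\{\omega\in\Omega:\omega_{\mathbb{V}\setminus V}=\tau_{\mathbb{V}\setminus V}\}$ for finite $V$, and $\Omega^{+}$ (resp. $\Omega^-$) the set of configurations agreeing with $\boldsymbol{+}$ (resp. $\boldsymbol{-}$) outside a finite set. $\Gamma$ acts by $(\gamma\omega)_v=\omega_{\gamma^{-1}v}$. An upwards specification is a family $\rho=\{\rho_V^\tau\}$ indexed by finite $V\subset\mathbb{V}$ and $\tau\in\Omega^+$, where $\rho_V^\tau$ is a probability measure supported on $\Omega_V^\tau$, such that for finite $U\subset V$ and $\tau,\tau'\in\Omega^+$: $\rho_V^\tau=\rho_V^{\tau'}$ whenever $\tau_{\mathbb{V}\setminus V}=\tau'_{\mathbb{V}\setminus V}$, and $\rho_V^\tau(\cdot\mid\Omega_U^\tau)=\rho_U^\tau$ whenever $\rho_V^\tau(\Omega_U^\tau)>0$. A downwards specification is the same with $\Omega^-$, $\boldsymbol{-}$ in place of $\Omega^+$, $\boldsymbol{+}$; an upwards-downwards specification is the same with $\Omega^+\cup\Omega^-$, equivalently a pair $(\rho^+,\rho^-)$ of an upwards and a downwards specification. $\rho$ is $\Gamma$-invariant if $\rho_{\gamma V}^{\gamma\tau}(\gamma^{-1}\omega\in\cdot)=\rho_V^\tau$ for all $\gamma\in\Gamma$,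 finite $V$ and admissible $\tau$. It is monotone if $\rho_V^\tau\le_{\mathrm{st}}\rho_V^{\tau'}$ (stochastic domination) for all finite $V$ and all admissible $\tau\le\tau'$ (for upwards-downwards: $\rho^+$ and $\rho^-$ are both monotone, and $\rho_V^\tau\le_{\mathrm{st}}\rho_V^{\tau'}$ for $\tau\in\Omega^-$, $\tau'\in\Omega^+$ with $\tau\le\tau'$). An upwards specification is irreducible if, for every finite $V$, the set $\{\omega\in\Omega^+:\rho_V^{\boldsymbol{+}}(\omega)>0\}$ contains $\boldsymbol{+}$ and is connected in the Hamming graph on $\Omega^+$ (configurations adjacent when they differ at exactly one vertex); analogously for downwards with $\boldsymbol{-}$; an upwards-downwards specification is irreducible if both $\rho^+$ and $\rho^-$ are. For a monotone upwards specification, $\rho_V^{\boldsymbol{+}}$ is stochastically decreasing in $V$ and $\mu^+:=\lim_{V\uparrow\mathbb{V}}\rho_V^{\boldsymbol{+}}$ denotes the weak limit, in general a sub-probability measure on $\Omega$ (a probability measure if $S$ is finite). Similarly $\mu^-:=\lim_{V\uparrow\mathbb{V}}\rho_V^{\boldsymbol{-}}$. $\mathbb{V}_{v,r}:=\{u:\mathrm{dist}(u,v)\le r\}$ with $\mathrm{dist}$ the graph distance in $G$; $\rho(\sigma_v\in\cdot)$ is the marginal at $v$; $\|\cdot\|_{TV}$ is total variation distance, $\|\mu-\nu\|_{TV}=\max_A|\mu(A)-\nu(A)|$. **Codings.** An action is quasi-transitive if it has finitely many orbits. All probability spaces are standard. A coding from a $\Gamma$-invariant $T$-valued random field $Y=(Y_v)_{v\in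 \mathbb{V}}$ to a $\Gamma$-invariant $S$-valued random field $X$ is a measurable map $\varphi:T^{\mathbb{V}}\to S^{\mathbb{V}}$ such that $\varphi(Y)$ has the law of $X$ and $\varphi$ commutes with every element of $\Gamma$ on a $\Gamma$-invariant set of full measure. The coding radius $R_v(y)\in\{0,1,2,\dots\}\cup\{\infty\}$ is the minimal $r$ such that $\varphi(y)_v=\varphi(y')_v$ for every $y'$ with $y'_w=y_w$ for all $w\in\mathbb{V}_{v,r}$ (up to modification on null sets); $R_v:=R_v(Y)$. The coding is finitary if $R_v<\infty$ a.s. for all $v$. $X$ (or its law) is $\Gamma$-fiid if there is a coding from some i.i.d. process $Y$ (the $Y_v$ independent and identically distributed) to $X$, and $\Gamma$-ffiid if there is a finitary such coding.
   Formalization: In the final claim (if μ⁺ = μ⁻ then μ⁺ is Γ-ffiid) the graph G is additionally assumed connected; without this it fails, e.g. for the high-temperature Ising specification on ℤ² viewed on the edgeless graph. *)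

(* Defs.v *)
From Stdlib Require Relation_Operators.
From HB Require Import structures.
From mathcomp Require Import all_boot all_order all_algebra.
From mathcomp Require Import finmap.
From mathcomp Require Import all_classical all_reals all_analysis.

Set Implicit Arguments.
Unset Strict Implicit.
Unset Printing Implicit Defensive.

Import Order.TTheory GRing.Theory Num.Theory.
Import numFieldNormedType.Exports.

Local Open Scope classical_set_scope.
Local Open Scope ring_scope.

Section graphs.
Variables (R : realType) (V : countType) (e : rel V).

Definition locally_finite := forall v, finite_set [set u | e v u].

(* +oo when v and u lie in different connected components *)
Definition gdist (v u : V) : \bar R :=
  ereal_inf [set (size p)%:R%:E | p in [set p | path e v p /\ last v p = u]].

Definition gball (v : V) (r : nat) : set V :=
  [set u | (gdist v u <= r%:R%:E)%E].

Definition connected_graph :=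
  forall v u : V, exists p, path e v p /\ last v p = u.

Variables (Gamma : groupType) (act : Gamma -> V -> V).

Definition is_left_action :=
  (forall v, act 1%g v = v) /\
  (forall g h v, act (g * h)%g v = act g (act h v)).

Definition by_automorphisms := forall g u v, e (act g u) (act g v) = e u v.

Definition quasi_transitive :=
  exists2 F : set V, finite_set F & forall v, exists g u, F u /\ v = act g u.

End graphs.

(* [spin S] is S with the discrete sigma-algebra; the top element only serves
   as the mandatory default point of a measurableType. *)
Definition spin (d : Order.disp_t) (S : tOrderType d) : Type := S.

HB.instance Definition _ (d : Order.disp_t) (S : tOrderType d) :=
  Order.TTotal.copy (spin S) S.
HB.instance Definition _ (d : Order.disp_t) (S : tOrderType d) :=
  isPointed.Build (spin S) (\top%O : S).
HB.instance Definition _ (d : Order.disp_t) (S : tOrderType d) :=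
  @isMeasurable.Build default_measure_display (spin S) discrete_measurable
    discrete_measurable0 discrete_measurableC discrete_measurableU.

Definition cylinders (V : Type) (d : measure_display) (T : measurableType d) :
    set (set (V -> T)) :=
  [set C | exists v (A : set T), measurable A /\ C = [set y | A (y v)]].

(* V -> T with the product sigma-algebra *)
Definition process (V : Type) (d : measure_display) (T : measurableType d) :=
  g_sigma_algebraType (@cylinders V d T).

HB.instance Definition _ (V : Type) (d : measure_display)
    (T : measurableType d) := Measurable.on (process V T).

Definition config (V : Type) (d : Order.disp_t) (S : tOrderType d) :=
  process V (spin S).

HB.instance Definition _ (V : Type) (d : Order.disp_t) (S : tOrderType d) :=
  Measurable.on (config V S).

Definition act_config (V T : Type) (Gamma : groupType) (act : Gamma -> V -> V)
    (g : Gamma) (w : V -> T) : V -> T :=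
  fun v => w (act g^-1%g v).

Section specifications.
Variables (R : realType) (V : countType).
Variables (d : Order.disp_t) (S : tOrderType d).
Notation Omega := (config V S).

Definition top_config : Omega := fun=> \top%O.

(* Omega_A^tau *)
Definition frozen_off (A : set V) (tau : Omega) : set Omega :=
  [set w | forall v, ~ A v -> w v = tau v].

(* Omega^+ and Omega^- are obtained by taking for eta the constant maximal,
   resp. minimal, configuration. *)
Definition finite_perturb (eta : Omega) : set Omega :=
  [set w | finite_set [set v | w v <> eta v]].

Definition config_le (w w' : Omega) := forall v, (w v <= w' v)%O.

Definition increasing_event (B : set Omega) :=
  forall w w', B w -> config_le w w' -> B w'.

Definition st_le (P Q : probability Omega R) :=
  forall B : set Omega, measurable B -> increasing_event B -> (P B <= Q B)%E.

Definition cond_prob (P : probability Omega R) (B C : set Omega) : R :=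
  fine (P (B `&` C)) / fine (P C).

(* Only the values of rho at finite sets and at admissible boundary conditions
   are meaningful, and all the predicates below only look at those. The same
   family rho then carries both rho^+ (admissible set Omega^+) and rho^-
   (admissible set Omega^-). *)
Definition spec_family := set V -> Omega -> probability Omega R.

Definition is_specification (adm : set Omega) (rho : spec_family) :=
  [/\ forall A tau, finite_set A -> adm tau ->
        rho A tau (frozen_off A tau) = 1%E,
      forall A tau tau', finite_set A -> adm tau -> adm tau' ->
        (forall v, ~ A v -> tau v = tau' v) ->
        forall B : set Omega, measurable B -> rho A tau B = rho A tau' B
    & forall U A tau, finite_set A -> U `<=` A -> adm tau ->
        (0 < rho A tau (frozen_off U tau))%E ->
        forall B : set Omega, measurable B ->
          cond_prob (rho A tau) B (frozen_off U tau) = fine (rho U tau B)].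

Definition invariant_spec (Gamma : groupType) (act : Gamma -> V -> V)
    (adm : set Omega) (rho : spec_family) :=
  forall g A tau, finite_set A -> adm tau ->
  forall B : set Omega, measurable B ->
    rho (act g @` A) (act_config act g tau)
      [set w : Omega | B (act_config act g^-1%g w : Omega)]
    = rho A tau B.

Definition monotone_spec (adm : set Omega) (rho : spec_family) :=
  forall A tau tau', finite_set A -> adm tau -> adm tau' ->
    config_le tau tau' -> st_le (rho A tau) (rho A tau').

Definition hamming_adjacent (w w' : Omega) :=
  exists v, forall u, w u <> w' u <-> u = v.

Definition hamming_connected (B : set Omega) :=
  forall w w', B w -> B w' ->
    Relation_Operators.clos_refl_trans Omega
      (fun a b => [/\ B a, B b & hamming_adjacent a b]) w w'.

(* irreducibility of the specification with admissible boundary conditions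
   [finite_perturb eta] *)
Definition irreducible_spec (eta : Omega) (rho : spec_family) :=
  forall A, finite_set A ->
    let supp := [set w | finite_perturb eta w /\ (0 < rho A eta [set w])%E] in
    supp eta /\ hamming_connected supp.

(* the filter of limits along finite sets increasing to V *)
Definition finite_sets_up : set_system (set V) :=
  [set Q | exists2 A0, finite_set A0 &
     forall A, finite_set A -> A0 `<=` A -> Q A].

(* Weak convergence of rho_A^eta to the probability measure mu as A increases to
   V, for the product of the discrete topologies. *)
Definition weak_limit (eta : Omega) (rho : spec_family)
    (mu : probability Omega R) :=
  forall f : Omega -> R,
    continuous (f : prod_topology (fun _ : V => discrete_topology S) -> R) ->
    (exists M, forall w, `|f w| <= M) ->
    (fun A => \int[rho A eta]_w (f w)%:E)%E @ finite_sets_up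
      --> (\int[mu]_w (f w)%:E)%E.

Definition marginal (P : probability Omega R) (v : V) :
    set (spin S) -> \bar R :=
  pushforward P (fun w : Omega => w v : spin S).

Definition tv_dist (m m' : set (spin S) -> \bar R) : R :=
  sup [set `|fine (m A) - fine (m' A)| | A in [set: set (spin S)]].

End specifications.

Arguments top_config {V d} S.
Arguments tv_dist {R d S}.

Definition bot_config (V : countType) (d : Order.disp_t)
    (S : finTBOrderType d) : config V S := fun=> \bot%O.

Arguments bot_config {V d} S.

Section upwards_downwards.
Variables (R : realType) (V : countType).
Variables (d : Order.disp_t) (S : finTBOrderType d).

Definition adm_updown : set (config V S) :=
  finite_perturb (top_config S) `|` finite_perturb (bot_config S).

Definition monotone_updown (rho : spec_family R V S) :=
  [/\ monotone_spec (finite_perturb (top_config S)) rho,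
      monotone_spec (finite_perturb (bot_config S)) rho
    & forall A tau tau', finite_set A ->
        finite_perturb (bot_config S) tau ->
        finite_perturb (top_config S) tau' ->
        config_le tau tau' -> st_le (rho A tau) (rho A tau')].

Definition irreducible_updown (rho : spec_family R V S) :=
  irreducible_spec (top_config S) rho /\ irreducible_spec (bot_config S) rho.

End upwards_downwards.

Arguments adm_updown {V d} S.

Section codings.
Variable R : realType.

(* isomorphic, as a measurable space, to a Polish space with its Borel sets *)
Definition standard_borel (d : measure_display) (T : measurableType d) :=
  exists (X : completePseudoMetricType R) (f : T -> X),
    [/\ hausdorff_space X,
        exists2 D : set X, countable D & dense D,
        bijective f
      & forall A : set T, measurable A <-> <<s (@open X) >> (f @` A)].

Variable V : countType.

Definition iid (d : measure_display) (T : measurableType d)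
    (P : probability (process V T) R) :=
  (forall u v (A : set T), measurable A ->
     P [set y | A (y u)] = P [set y | A (y v)]) /\
  (forall (F : {fset V}) (A : V -> set T), (forall v, measurable (A v)) ->
     P [set y | forall v, v \in F -> A v (y v)]
     = (\prod_(v <- F) P [set y | A v (y v)])%E).

Variables (Gamma : groupType) (act : Gamma -> V -> V).

(* [phi] is a coding from a process of law P to a process of law mu. *)
Definition is_coding (d d' : measure_display) (T : measurableType d)
    (U : measurableType d') (P : probability (process V T) R)
    (mu : probability (process V U) R) (phi : process V T -> process V U) :=
  [/\ measurable_fun [set: process V T] phi,
      forall B : set (process V U), measurable B -> P (phi @^-1` B) = mu B
    & exists D : set (process V T),
        [/\ measurable D, P D = 1%E,
            forall g y, D y -> D (act_config act g y)
          & forall g y, D y ->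
              phi (act_config act g y) = act_config act g (phi y)]].

Variable e : rel V.

(* [D] is a set of full measure outside which configurations are discarded *)
Definition coding_radius_on (d d' : measure_display) (T : measurableType d)
    (U : measurableType d') (D : set (process V T))
    (phi : process V T -> process V U) (v : V) (y : process V T) : \bar R :=
  ereal_inf [set r%:R%:E | r in [set r : nat | forall y', D y' ->
    (forall w, gball R e v r w -> y' w = y w) -> phi y' v = phi y v]].

(* [rad] is the coding radius of phi, up to modification on a P-null set *)
Definition is_coding_radius (d d' : measure_display) (T : measurableType d)
    (U : measurableType d') (P : probability (process V T) R)
    (phi : process V T -> process V U) (rad : V -> process V T -> \bar R) :=
  exists D : set (process V T),
    [/\ measurable D, P D = 1%E & rad = coding_radius_on D phi].

(* The event {rad v > r} need not be measurable for the product sigma-algebra;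
   its probability is taken in the outer measure of P, which extends the
   completion of P. *)
Definition prob_radius_gt (d : measure_display) (T : measurableType d)
    (P : probability (process V T) R) (rad : V -> process V T -> \bar R)
    (v : V) (r : nat) : \bar R :=
  mu_ext P [set y | (r%:R%:E < rad v y)%E].

Definition fiid (d' : measure_display) (U : measurableType d')
    (mu : probability (process V U) R) :=
  exists (d : measure_display) (T : measurableType d)
    (P : probability (process V T) R) (phi : process V T -> process V U),
    [/\ standard_borel T, iid P & is_coding P mu phi].

Definition ffiid (d' : measure_display) (U : measurableType d')
    (mu : probability (process V U) R) :=
  exists (d : measure_display) (T : measurableType d)
    (P : probability (process V T) R) (phi : process V T -> process V U)
    (rad : V -> process V T -> \bar R),
    [/\ standard_borel T, iid P, is_coding P mu phi,
        is_coding_radius P phi rad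
      & forall v, {ae P, forall y, (rad v y < +oo)%E}].

End codings.

(* Main.v *)
(** Sample the vertices of a finite volume A one at a time, in the order given by
    i.i.d. priorities, each from its conditional law given the values sampled so
    far and the boundary condition, by inserting an independent uniform variable
    in the quantile function.  The resulting configuration on A has law
    [rho_A^+] (resp. [rho_A^-]) exactly.  Monotonicity and the domain Markov
    property make the sample with boundary condition + pointwise decreasing in A,
    and everywhere above the samples with boundary condition - in smaller
    volumes.  If the weak limit is a probability measure, the decreasing values
    at each vertex are eventually constant almost surely; the eventual value
    commutes with the group (the random order is equivariant up to ties) and has
    law [mu^+].  It is squeezed between the two samples in the ball of radius r,
    which depend on the randomness in that ball only, so the coding radius at v
    exceeds r only where these two samples differ at v.  A union bound over the
    levels of S then produces the factor |S| - 1. *)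

Require Import Defs.
From HB Require Import structures.
From mathcomp Require Import all_boot all_order all_algebra.
From mathcomp Require Import finmap.
From mathcomp Require Import all_classical all_reals all_analysis.
From mathcomp Require Import measurable_realfun ring lra.

Import Order.TTheory GRing.Theory Num.Theory.
Import numFieldNormedType.Exports.

Set Implicit Arguments.
Unset Strict Implicit.
Unset Printing Implicit Defensive.

Local Open Scope classical_set_scope.
Local Open Scope ring_scope.

(** * Laws of processes indexed by a countable set *)

(** No fixed enumeration of the vertices is respected by the group, hence the random order. It
    leaves the law intact because sampling along any deterministic list already produces the
    prescribed law. Different volumes are coupled because the order on A is the restriction of the
    order on a larger A': both samplings visit the common vertices in the same order with the same
    uniforms, while at an extra vertex the smaller volume keeps the extreme boundary value. Two
    obstacles come from countable S. When S is order-dense a quantile need not be attained, so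
    regular uniforms are singled out; they are almost sure for all boundary conditions at once,
    since only countably many configurations differ finitely from a given one. And decreasing values
    may fail to stabilise; this is excluded because the mass that the limit gives to a value is a
    lower bound for the probability of settling there, and these masses add up to one. The source is
    one real per vertex, whose binary digits yield both priority and uniform; the whole i.i.d. field
    is itself read off the digits of a single uniform variable. *)

Lemma measurable_eval (V : Type) d (T : measurableType d) (v : V) :
  measurable_fun [set: process V T] (fun y : process V T => y v).
Proof.
move=> _ A mA; rewrite setTI; apply: sub_sigma_algebra.
by exists v, A.
Qed.

Lemma measurable_fun_process (V : Type) d (T : measurableType d)
    d' (X : measurableType d') (f : X -> process V T) :
  (forall v, measurable_fun [set: X] (fun x => f x v)) ->
  measurable_fun [set: X] f.
Proof.
move=> mf; apply: (@measurability _ _ _ (process V T) _ _ (@cylinders V d T)) => //.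
move=> _ [_ [v [A [mA ->]]] <-].
have := mf v measurableT A mA; congr measurable.
Qed.

Lemma measurable_coord (V : Type) d (T : measurableType d) (v : V) (A : set T) :
  measurable A -> measurable [set y : process V T | A (y v)].
Proof.
by move=> mA; have := @measurable_eval V d T v measurableT A mA; rewrite setTI.
Qed.

Definition rectangle (V : eqType) (T : Type) (F : seq V) (A : V -> set T) :
    set (V -> T) :=
  [set y | forall v, v \in F -> A v (y v)].

Lemma rectangle_nil (V : eqType) (T : Type) (A : V -> set T) :
  rectangle [::] A = setT.
Proof. by apply/seteqP; split. Qed.

Lemma rectangle_cons (V : eqType) (T : Type) v (F : seq V) (A : V -> set T) :
  rectangle (v :: F) A = [set y | A v (y v)] `&` rectangle F A.
Proof.
apply/seteqP; split => y /=.
  by move=> h; split => [|u uF]; apply: h; rewrite inE ?eqxx ?uF ?orbT.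
by move=> [h1 h2] u; rewrite inE => /orP[/eqP->|/h2].
Qed.

Lemma measurable_rectangle (V : eqType) d (T : measurableType d)
    (F : seq V) (A : V -> set T) : (forall v, measurable (A v)) ->
  measurable (rectangle F A : set (process V T)).
Proof.
move=> mA; elim: F => [|v F IH]; first by rewrite rectangle_nil.
by rewrite rectangle_cons; apply: measurableI => //; exact: measurable_coord.
Qed.

Lemma measurable_preimageT d (X : measurableType d) d' (Y : measurableType d')
    (f : X -> Y) (A : set Y) : measurable_fun [set: X] f -> measurable A ->
  measurable (f @^-1` A).
Proof. by move=> mf mA; rewrite -[_ @^-1` _]setTI; exact: mf. Qed.

Section uniqueness.
Variables (R : realType) (V : eqType) (d : measure_display).
Variables (T : measurableType d).

Let rectangles : set (set (process V T)) :=
  [set C | exists F (A : V -> set T), (forall v, measurable (A v)) /\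
    C = rectangle F A].

Let rectanglesI : setI_closed rectangles.
Proof.
move=> _ _ [F [A [mA ->]]] [G [B [mB ->]]].
exists (F ++ G), (fun v => (if v \in F then A v else setT) `&`
                     (if v \in G then B v else setT)); split.
  by move=> v; apply: measurableI; case: ifP.
apply/seteqP; split => y /=.
  move=> [hA hB] v; rewrite mem_cat => _; split.
    by case: ifPn => // /hA.
  by case: ifPn => // /hB.
move=> h; split=> v vF; have := h v; rewrite mem_cat vF ?orbT.
  by move=> /(_ isT)[].
by move=> /(_ isT)[].
Qed.

Let measurable_rectangles :
  (measurable : set (set (process V T))) = <<s rectangles >>.
Proof.
apply/seteqP; split; last first.
  apply: smallest_sub; first exact: sigma_algebra_measurable.
  by move=> _ [F [A [mA ->]]]; exact: measurable_rectangle.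
apply: smallest_sub; first exact: smallest_sigma_algebra.
move=> _ [v [A [mA ->]]]; apply: sub_sigma_algebra.
exists [:: v], (fun=> A); split => //.
by apply/seteqP; split => y /=; [move=> Ay u; rewrite inE => /eqP->|apply; rewrite inE].
Qed.

(** Rectangles are stable under intersection and generate the product sigma-algebra, so they
    determine a finite measure. *)
Lemma process_measure_unique (m1 m2 : {measure set (process V T) -> \bar R}) :
  (m1 setT < +oo)%E ->
  (forall F (A : V -> set T), (forall v, measurable (A v)) ->
    m1 (rectangle F A) = m2 (rectangle F A)) ->
  forall B : set (process V T), measurable B -> m1 B = m2 B.
Proof.
move=> m1oo h B mB.
apply: (measure_unique rectangles (fun=> setT)) => //.
- by move=> _; exists [::], (fun=> setT); rewrite rectangle_nil.
- by apply/seteqP; split => // y _; exists 0%N.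
- by move=> _ [F [A [mA ->]]]; exact: h.
Qed.

(** Lifts independence from rectangles to all measurable sets: with [c] the probability of [E], the
    hypothesis says on rectangles that [f] has law [Q] independently of [E]. Both sides are finite
    measures in [B], namely the image of [P] restricted to [E] and a multiple of [Q]. *)
Lemma process_law_unique d' (X : measurableType d')
    (P : {finite_measure set X -> \bar R}) (E : set X) (f : X -> process V T)
    (c : R) (Q : {measure set (process V T) -> \bar R}) :
  measurable E -> measurable_fun [set: X] f -> 0 <= c ->
  (forall F (A : V -> set T), (forall v, measurable (A v)) ->
    P (E `&` f @^-1` (rectangle F A)) = (c%:E * Q (rectangle F A))%E) ->
  forall B : set (process V T), measurable B ->
    P (E `&` f @^-1` B) = (c%:E * Q B)%E.
Proof.
move=> mE mf c0 h B mB.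
pose m1 : {measure set (process V T) -> \bar R} :=
  pushforward (mrestr P mE) f.
pose m2 : {measure set (process V T) -> \bar R} := mscale (NngNum c0) Q.
have /= := @process_measure_unique (m1 mf) m2.
rewrite /m1 /m2 /pushforward /mrestr /mscale /= -[E `&` _]setIC => -> //.
- rewrite ltey_eq fin_num_measure//.
  by apply: measurableI => //; exact: measurable_preimageT.
- by move=> F A mA; rewrite setIC h.
Qed.

End uniqueness.

Lemma pushforward_probability (R : realType) d (X : measurableType d)
    d' (Y : measurableType d') (P : probability X R) (f : X -> Y) :
  measurable_fun [set: X] f ->
  exists Q : probability Y R, forall A, Q A = P (f @^-1` A).
Proof.
move=> mf.
pose F : {mfun X >-> Y} := mfun_Sub (mem_set mf).
by exists (distribution P F).
Qed.

(** * Binary digits of a uniform variable *)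

Section unit_law.
Variable R : realType.

(** The uniform law, as a measure on all of [R]. The interval is half-open because the doubling map
    sends it to itself. *)
Definition unit_law (A : set R) : \bar R :=
  lebesgue_measure (A `&` `[0, 1[%classic).

(* [lebesgue_measure] lives on [measurableTypeR R], which has the same
   measurable sets as [R] but another display. *)
Let restricted : {measure set (measurableTypeR R) -> \bar R} :=
  mrestr lebesgue_measure (measurable_itv `[0, 1[).

Let unit_law0 : unit_law set0 = 0%E. Proof. exact: (measure0 restricted). Qed.

Let unit_law_ge0 A : (0 <= unit_law A)%E.
Proof. exact: (measure_ge0 restricted). Qed.

Let unit_law_sigma_additive : semi_sigma_additive unit_law.
Proof. exact: (@measure_semi_sigma_additive _ _ _ restricted). Qed.

HB.instance Definition _ := isMeasure.Build _ _ _ unit_law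
  unit_law0 unit_law_ge0 unit_law_sigma_additive.

Let unit_lawT : unit_law setT = 1%E.
Proof.
by rewrite /unit_law setTI lebesgue_measure_itv/= lte_fin ltr01 oppr0 adde0.
Qed.

HB.instance Definition _ := Measure_isProbability.Build _ _ _ unit_law unit_lawT.

Lemma unit_law_itv (a b : R) : 0 <= a -> a <= b -> b <= 1 ->
  unit_law [set x | a <= x < b] = (b - a)%:E.
Proof.
move=> a0 ab b1; rewrite /unit_law.
rewrite (_ : _ `&` _ = `[a, b[%classic); last first.
  apply/seteqP; split => x /=; rewrite !in_itv/=; first by case.
  move=> /andP[ax xb].
  by rewrite ax xb (le_trans a0 ax) (lt_le_trans xb b1).
rewrite lebesgue_measure_itv/= lte_fin; case: ltP => [//|ba].
by rewrite (@le_anti _ _ a b) ?ab// subrr.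
Qed.

(** Twice the image of Lebesgue measure under x -> 2x - c gives every interval its length, hence is
    Lebesgue measure. *)
Lemma lebesgue_measure_double (c : R) (A : set R) : measurable A ->
  (lebesgue_measure ((fun x : R => 2 * x - c)%R @^-1` A) =
  2^-1%:E * lebesgue_measure A)%E.
Proof.
move=> mA; set f := (fun x : R => 2 * x - c).
have mf : measurable_fun [set: R] f.
  by apply: measurable_funB => //; exact: measurable_funM.
have mf' : measurable_fun [set: measurableTypeR R] (f : measurableTypeR R -> measurableTypeR R).
  exact: mf.
have h2 : 0 <= 2 :> R by [].
pose m : {measure set (measurableTypeR R) -> \bar R} :=
  mscale (NngNum h2) (pushforward (@lebesgue_measure R)
    (f : measurableTypeR R -> measurableTypeR R)).
rewrite [in RHS](@lebesgue_measure_unique R (m mf')) //.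
  by rewrite /m /mscale /= /pushforward muleA -EFinM mulVf// mul1e.
move=> _ [[a b] /= _ <-]; rewrite /m /mscale /pushforward /=.
rewrite /mscale /pushforward /=.
rewrite [X in (_ = _ * lebesgue_measure X)%E](_ : _ = `](a + c) / 2, (b + c) /
    2]%classic); last first.
  apply/seteqP; split => x /=; rewrite !in_itv/= /f; lra.
rewrite !lebesgue_measure_itv/= !lte_fin ltr_pM2r// ltrD2r.
case: ifP => _; last by rewrite mule0.
by rewrite -!EFinB -EFinM; congr EFin; lra.
Qed.

End unit_law.

Section digits.
Variable R : realType.
Notation lambda := (@unit_law R).

Definition leading_bit (x : R) : bool := 2^-1 <= x.
(** On [0, 1[ this is the map 2x mod 1, whose itinerary through the two halves is the binary
    expansion. *)
Definition doubling (x : R) : R := 2 * x - (leading_bit x)%:R.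
Definition digits (x : R) : process nat bool :=
  fun k => leading_bit (iter k doubling x).

Lemma doubling_itv (x : R) : 0 <= x < 1 -> 0 <= doubling x < 1.
Proof.
by rewrite /doubling /leading_bit; case: (leP (2^-1) x) => /=; rewrite -?[1%:R]/(1 : R); lra.
Qed.

Lemma halving_itv (x : R) (c : bool) : 0 <= 2 * x - c%:R < 1 ->
  0 <= x < 1 /\ leading_bit x = c.
Proof.
rewrite /leading_bit; case: c; rewrite -?[true%:R]/(1 : R) -?[false%:R]/(0 : R).
  by move=> h; split; [lra|apply/idP; lra].
by move=> h; split; [lra|apply/negbTE; rewrite -ltNge; lra].
Qed.

Lemma measurable_leading_bit : measurable_fun [set: R] leading_bit.
Proof. by apply: measurable_fun_ler. Qed.

Lemma measurable_doubling : measurable_fun [set: R] doubling.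
Proof.
rewrite (_ : doubling = fun x => if leading_bit x then 2 * x - 1 else 2 * x).
  apply: measurable_fun_ifT; first exact: measurable_leading_bit.
    by apply: measurable_funB => //; exact: measurable_funM.
  by apply: measurable_funM.
by apply/funext => x; rewrite /doubling; case: ifP => _; rewrite ?subr0.
Qed.

Lemma measurable_digits : measurable_fun [set: R] digits.
Proof.
apply: measurable_fun_process => k.
apply: (measurableT_comp measurable_leading_bit).
elim: k => [|k IH]; first exact: measurable_id.
exact: (measurableT_comp measurable_doubling).
Qed.

Definition coin (A : set bool) : \bar R :=
  (2^-1 * ((true \in A)%:R + (false \in A)%:R))%:E.

(** Doubling maps each half of [0, 1[ affinely onto [0, 1[, so the leading bit is a fair coin
    independent of the doubled value, which is again uniform. Iteration makes the digits independent
    fair coins. *)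
Lemma unit_law_leading_bit (A : set bool) (B : set R) : measurable B ->
  lambda [set x | A (leading_bit x) /\ B (doubling x)] = (coin A * lambda B)%E.
Proof.
move=> mB.
have mC : measurable (B `&` `[0, 1[%classic : set R) by apply: measurableI.
pose H (c : bool) := [set x : R | 0 <= x < 1 /\ leading_bit x = c /\ B (doubling x)].
have mH c : measurable (H c).
  have -> : H c = (leading_bit @^-1` [set c] `&` doubling @^-1` B) `&` `[0, 1[%classic.
    by apply/seteqP; split => x; rewrite /H/= in_itv/=;
      [move=> [? [? ?]]|move=> [[? ?] ?]].
  apply: measurableI => //; apply: measurableI.
    by apply: measurable_preimageT => //; exact: measurable_leading_bit.
  by apply: measurable_preimageT => //; exact: measurable_doubling.
have lH c : lebesgue_measure (H c) = (2^-1%:E * lambda B)%E.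
  rewrite /unit_law -(lebesgue_measure_double c%:R)//; congr lebesgue_measure.
  apply/seteqP; split => x; rewrite /H/= !in_itv/=.
    move=> [x01 [<- Bx]]; split=> //; exact: doubling_itv.
  move=> [Bx /halving_itv[x01 xc]]; split => //; split => //.
  by rewrite /doubling xc.
have -> : lambda [set x | A (leading_bit x) /\ B (doubling x)] =
  lebesgue_measure ((if true \in A then H true else set0) `|`
                    (if false \in A then H false else set0)).
  rewrite /unit_law; congr lebesgue_measure.
  apply/seteqP; split => x /=; rewrite in_itv/=.
    move=> [[Ax Bx] x01].
    by case E : (leading_bit x) Ax => /mem_set ->; [left|right].
  by case=> + ; (case: ifP => //; rewrite inE => Ac [x01 [-> Bx]]).
have mif (b c : bool) : measurable (if b then H c else set0) by case: b.
rewrite measureU; [|exact: mif|exact: mif|]; last first.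
  apply/seteqP; split => // x [] /=; case: ifP => // _ [_ [+ _]].
  by case: ifP => // _ + [_ [+ _]] => ->.
rewrite /coin mulrDr EFinD ge0_muleDl ?lee_fin ?mulr_ge0 ?invr_ge0//.
by congr (_ + _)%E; case: (_ \in A);
  [rewrite mulr1; exact: lH|rewrite mulr0 mul0e; exact: measure0|
   rewrite mulr1; exact: lH|rewrite mulr0 mul0e; exact: measure0].
Qed.

Lemma unit_law_digits_iota (n : nat) (A : nat -> set bool) :
  lambda [set x | forall k, (k < n)%N -> A k (digits x k)] =
  (\prod_(k <- iota 0 n) coin (A k))%E.
Proof.
elim: n A => [|n IH] A.
  rewrite big_nil (_ : [set _ | _] = setT) ?probability_setT//.
  by apply/seteqP; split.
rewrite /= big_cons -[1%N]/(1 + 0)%N iotaDl big_map -(IH (fun k => A k.+1)).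
rewrite -unit_law_leading_bit; last first.
  rewrite (_ : [set _ | _] = digits @^-1` rectangle (iota 0 n) (fun k => A k.+1)).
    apply: measurable_preimageT; first exact: measurable_digits.
    exact: measurable_rectangle.
  by apply/seteqP; split => x /= h k; have := h k; rewrite mem_iota.
congr (lambda _); apply/seteqP; split => x /=.
  move=> h; split; first exact: (h 0%N).
  by move=> k kn; have := h k.+1 kn; rewrite /digits iterSr.
by move=> [h0 h] [|k] // kn; rewrite /digits iterSr; exact: h.
Qed.

Lemma unit_law_digits (K : seq nat) (A : nat -> set bool) : uniq K ->
  lambda (digits @^-1` rectangle K A) = (\prod_(k <- K) coin (A k))%E.
Proof.
move=> uK; pose n := (\max_(k <- K) k).+1.
have Kn k : k \in K -> (k < n)%N.
  by move=> kK; rewrite ltnS; exact: leq_bigmax_seq.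
clearbody n.
pose B k := if k \in K then A k else setT.
transitivity (lambda [set x | forall k, (k < n)%N -> B k (digits x k)]).
  congr (lambda _); apply/seteqP; split => x /= h k.
    by rewrite /B; case: ifPn => // kK _; exact: h.
  by move=> kK; have := h k (Kn _ kK); rewrite /B kK.
rewrite unit_law_digits_iota (bigID (mem K))/= [X in (_ * X)%E]big1 => [|k kK].
  rewrite mule1 -big_filter (perm_big K); last first.
    apply: uniq_perm => //; first exact/filter_uniq/iota_uniq.
    by move=> k; rewrite mem_filter mem_iota add0n; case: (boolP (k \in K)) => // /Kn.
  by apply: eq_big_seq => k kK; rewrite /B kK.
rewrite /B (negbTE kK) /coin !in_setT; congr EFin.
by rewrite -[1 + 1]/(2%:R) mulVf.
Qed.

End digits.

(** * Independent uniform variables *)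

Section binary_value.
Variable R : realType.
Notation lambda := (@unit_law R).

Definition binary_sum (n : nat) (b : process nat bool) : R :=
  \sum_(k < n) (b k)%:R / 2 ^+ k.+1.

Definition binary_value (b : process nat bool) : R :=
  limn (fun n => binary_sum n b).

Lemma cvg_binary_sum b : (fun n => binary_sum n b) @ \oo --> binary_value b.
Proof.
apply: nondecreasing_is_cvgn.
  apply/nondecreasing_seqP => n.
  by rewrite /binary_sum big_ord_recr/= lerDl divr_ge0// exprn_ge0.
exists 1 => _ [n _ <-].
suff : binary_sum n b <= 1 - 2^-1 ^+ n.
  by move/le_trans; apply; rewrite gerBl exprn_ge0.
elim: n => [|n IH]; first by rewrite /binary_sum big_ord0 expr0 subrr.
rewrite /binary_sum big_ord_recr/= -/(binary_sum n b).
apply: le_trans (lerD IH (_ : _ <= 2^-1 ^+ n.+1)) _.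
  by rewrite exprVn ler_piMl ?invr_ge0 ?exprn_ge0// lern1 leq_b1.
by rewrite exprS; lra.
Qed.

Lemma measurable_binary_value : measurable_fun [set: process nat bool] binary_value.
Proof.
apply: (measurable_fun_cvg (h := binary_sum)); last by move=> b _; exact: cvg_binary_sum.
move=> n; rewrite /binary_sum; apply: measurable_sum => k.
apply: measurable_funM => //.
have mb : measurable_fun [set: bool] (fun b : bool => b%:R : R) by [].
exact: (measurableT_comp mb (measurable_eval (T := bool) (k : nat))).
Qed.

Lemma binary_value_digits (x : R) : 0 <= x < 1 -> binary_value (digits x) = x.
Proof.
move=> x01; apply/cvg_lim => //.
have itv n : 0 <= iter n (@doubling R) x < 1.
  by elim: n => [//|n IH]; rewrite iterS; exact: doubling_itv.
(* The error after n digits is the n-th doubling iterate scaled by 2^-n, and the iterate stays in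
   [0, 1[. *)
have xE n : binary_sum n (digits x) = x - 2^-1 ^+ n * iter n (@doubling R) x.
  elim: n => [|n IH]; first by rewrite /binary_sum big_ord0 expr0 mul1r subrr.
  rewrite /binary_sum big_ord_recr/= -/(binary_sum n _) IH /digits.
  rewrite {3}/doubling -exprVn exprS; lra.
rewrite (funext xE) -[X in _ --> X]subr0; apply: cvgB; first exact: cvg_cst.
apply: (@squeeze_cvgr _ _ _ _ (fun=> 0) (fun n => 2^-1 ^+ n)).
- near=> n; have /andP[h0 h1] := itv n.
  by rewrite mulr_ge0 ?exprn_ge0//= ler_piMr ?exprn_ge0// ltW.
- exact: cvg_cst.
- by apply: cvg_expr; rewrite ger0_norm// invf_lt1// ltr1n.
Unshelve. all: by end_near. Qed.

Lemma unit_law_binary_value (A : set R) : measurable A ->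
  lambda ((binary_value \o (@digits R)) @^-1` A) = lambda A.
Proof.
move=> mA; rewrite /unit_law; congr lebesgue_measure.
apply/seteqP; split => x /=; rewrite in_itv/= => -[Ax x01]; split => //.
  by rewrite -(binary_value_digits x01).
by rewrite binary_value_digits.
Qed.

End binary_value.

Section streams.
Variable R : realType.
Notation lambda := (@unit_law R).
Variables (I : eqType) (J : I -> nat -> nat).
Hypothesis J_inj : forall i j m n, J i m = J j n -> i = j /\ m = n.

(** [J i n] is the position of the n-th digit allotted to [i]; its injectivity in both arguments
    makes the allotments disjoint. *)
Definition stream (i : I) (b : process nat bool) : process nat bool :=
  fun n => b (J i n).

Lemma measurable_stream i : measurable_fun [set: process nat bool] (stream i).
Proof. by apply: measurable_fun_process => n; exact: measurable_eval. Qed.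

Let undup_rectangle (K : seq nat) (A : nat -> set bool) :
  rectangle (undup K) A = rectangle K A.
Proof. by apply/seteqP; split => y /= h v vK; apply: h; rewrite mem_undup in vK *. Qed.

Let measurable_streams (F : seq I) (B : I -> set (process nat bool)) :
  (forall i, measurable (B i)) ->
  measurable [set x : R | forall i, i \in F -> B i (stream i (digits x))].
Proof.
move=> mB; rewrite (_ : [set _ | _] =
  (fun x : R => (fun i => stream i (digits x)) : process I (process nat bool))
    @^-1` rectangle F B); last by [].
apply: measurable_preimageT; last exact: measurable_rectangle.
apply: measurable_fun_process => i.
apply: (measurableT_comp (measurable_stream i)); exact: measurable_digits.
Qed.

Let cylinder_indep i (K K' : seq nat) (A A' : nat -> set bool) :
  uniq K -> uniq K' -> (forall k n, k \in K -> k <> J i n) ->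
  exists A'' : nat -> set bool,
  (fun b => rectangle K A b /\ rectangle K' A' (stream i b)) =
    rectangle (K ++ map (J i) K') A'' /\
  lambda (@digits R @^-1` rectangle (K ++ map (J i) K') A'') =
  (lambda (@digits R @^-1` rectangle K A) *
   lambda (@digits R @^-1` rectangle K' A'))%E.
Proof.
move=> uK uK' KJ.
have Ji : injective (J i) by move=> m n /J_inj[].
(* Positions in [K] keep their own constraint and position [J i n] inherits that of [n]. The default
   0 is met only at positions outside the rectangle. *)
pose A'' k := if k \in K then A k else A' (xget 0%N [set n | J i n = k]).
have A''J n : A'' (J i n) = A' n.
  rewrite /A''; case: ifPn => [/(KJ _ n)//|_]; congr A'.
  by apply: xget_unique => // m /= /Ji.
exists A''; split.
  apply/seteqP; split => b /=.
    move=> [h h'] k; rewrite mem_cat => /orP[kK|/mapP[n nK' ->]].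
      by rewrite /A'' kK; exact: h.
    by rewrite A''J; exact: h'.
  move=> h; split => k kK.
    by have := h k; rewrite mem_cat kK /A'' kK; exact.
  have := h (J i k); rewrite A''J; apply.
  by rewrite mem_cat map_f ?orbT.
rewrite !unit_law_digits// ?cat_uniq ?uK ?map_inj_uniq ?uK'//=; last first.
  by rewrite andbT; apply/hasPn => _ /mapP[n _ ->]; apply/negP => /(KJ _ n).
rewrite big_cat big_map/=; congr (_ * _)%E.
  by apply: eq_big_seq => k kK; rewrite /A'' kK.
by apply: eq_bigr => k _; rewrite A''J.
Qed.

(** The cylinder on the extra digits [K] drives the induction: a rectangle for the stream of the
    head is a condition on finitely many digits, absorbed into [K] before the induction hypothesis
    is applied to the tail. Then [process_law_unique] replaces the rectangle by [B i]. *)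
Lemma streams_indep (F : seq I) (B : I -> set (process nat bool)) :
  uniq F -> (forall i, measurable (B i)) ->
  forall (K : seq nat) (A : nat -> set bool), uniq K ->
  (forall k i n, k \in K -> i \in F -> k <> J i n) ->
  lambda [set x | rectangle K A (digits x) /\
                  forall i, i \in F -> B i (stream i (digits x))] =
  (lambda (@digits R @^-1` rectangle K A) *
   \prod_(i <- F) lambda (@digits R @^-1` B i))%E.
Proof.
move=> + mB; elim: F => [_ K A uK _|i F IH /= /andP[iF uF] K A uK KJ].
  rewrite big_nil mule1; congr (lambda _).
  by apply/seteqP; split => x //= -[].
have {}IH := IH uF.
pose E := [set x : R | rectangle K A (digits x) /\
                  forall i, i \in F -> B i (stream i (digits x))].
have mE : measurable E.
  apply: measurableI; last exact: measurable_streams.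
  by apply: (measurable_preimageT (@measurable_digits R)); exact: measurable_rectangle.
have [Q QE] := @pushforward_probability R _ _ _ _ (@unit_law R) _ (@measurable_digits R).
have cE : exists2 c : R, 0 <= c & lambda E = c%:E.
  exists (fine (lambda E)); first by rewrite fine_ge0.
  by rewrite fineK// fin_num_measure.
have [c c0 lE] := cE.
have H : forall C, measurable C ->
  lambda (E `&` (stream i \o @digits R) @^-1` C) = (c%:E * Q C)%E.
  apply: process_law_unique => //.
    apply: measurableT_comp; [exact: measurable_stream|exact: measurable_digits].
  move=> K' A' mA'; rewrite -undup_rectangle /= QE -lE.
  have KJi k n : k \in K -> k <> J i n.
    by move=> kK; apply: KJ; rewrite ?inE ?eqxx.
  have [A'' [AE lA]] := @cylinder_indep i K (undup K') A A' uK (undup_uniq _) KJi.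
  transitivity (lambda [set x | rectangle (K ++ map (J i) (undup K')) A'' (digits x) /\
                  forall i, i \in F -> B i (stream i (digits x))]).
    rewrite -AE; congr (lambda _); apply/seteqP; split => x /=.
      by move=> [[? ?] ?].
    by move=> [[? ?] ?].
  have uKK : uniq (K ++ map (J i) (undup K')).
    rewrite cat_uniq uK map_inj_uniq ?undup_uniq ?andbT; last by move=> m n /J_inj[].
    by apply/hasPn => _ /mapP[n _ ->]; apply/negP => /(KJi _ n).
  have dKK j : forall k n, k \in K ++ map (J i) (undup K') -> j \in F -> k <> J j n.
    move=> k n; rewrite mem_cat => /orP[kK jF|/mapP[m _ ->] jF].
      by apply: KJ => //; rewrite inE jF orbT.
    by move=> /J_inj[ij _]; move: iF; rewrite ij jF.
  rewrite IH//; last by move=> k j n kK jF; exact: (dKK j).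
  rewrite lA /E IH//; last by move=> k j n kK jF; apply: KJ => //; rewrite inE jF orbT.
  by rewrite -!muleA; congr (_ * _)%E; rewrite muleC.
rewrite big_cons muleCA -IH//; last first.
  by move=> k j n kK jF; apply: KJ => //; rewrite inE jF orbT.
rewrite -/E lE -QE muleC -H//; congr (lambda _); apply/seteqP; split => x /=.
  move=> [h h']; split; last by apply: h'; rewrite inE eqxx.
  by split => // j jF; apply: h'; rewrite inE jF orbT.
move=> [[h h'] Bi]; split => // j; rewrite inE => /orP[/eqP ->//|]; exact: h'.
Qed.

End streams.

(** Pairing splits the digit positions into one infinite stream per index. Each stream is again a
    sequence of fair coins, so its binary value is uniform. *)
Lemma unit_law_indep (R : realType) (I : countType) :
  exists Y : I -> R -> R, (forall i, measurable_fun [set: R] (Y i)) /\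
  forall (F : seq I) (A : I -> set R), uniq F -> (forall i, measurable (A i)) ->
    @unit_law R [set x | forall i, i \in F -> A i (Y i x)] =
    (\prod_(i <- F) @unit_law R (A i))%E.
Proof.
pose J (i : I) (n : nat) : nat := choice.pickle (i, n).
have J_inj i j m n : J i m = J j n -> i = j /\ m = n.
  by move/(pcan_inj choice.pickleK) => [-> ->].
pose Y i (x : R) := @binary_value R (stream J i (digits x)).
exists Y; split => [i|F A uF mA].
  apply: (measurableT_comp (@measurable_binary_value R)).
  apply: (measurableT_comp (measurable_stream J i)); exact: measurable_digits.
pose B i : set (process nat bool) := @binary_value R @^-1` A i.
have mB i : measurable (B i).
  by apply: measurable_preimageT => //; exact: measurable_binary_value.
have := @streams_indep R I J J_inj F B uF mB [::] (fun=> setT) isT _.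
rewrite rectangle_nil preimage_setT probability_setT mul1e => H.
transitivity (\prod_(i <- F) @unit_law R (@digits R @^-1` B i))%E.
  rewrite -H//; congr (unit_law _); apply/seteqP; split => x //=.
  by case.
by apply: eq_bigr => i _; rewrite -[RHS]unit_law_binary_value.
Qed.

(** Each vertex carries a single real, which has to provide both a priority and an independent
    uniform. *)
Lemma unit_law_split (R : realType) : exists w u : R -> R,
  [/\ measurable_fun setT w, measurable_fun setT u &
   forall A B, measurable A -> measurable B ->
   @unit_law R (w @^-1` A `&` u @^-1` B) = (unit_law A * unit_law B)%E].
Proof.
have [Y [mY YE]] := @unit_law_indep R bool.
exists (Y true), (Y false); split => // A B mA mB.
pose C (b : bool) := if b then A else B.
have := YE [:: true; false] C isT; rewrite !big_cons big_nil mule1 => <-; last by case.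
congr (unit_law _); apply/seteqP; split => x /=.
  by move=> [h1 h2]; case.
by move=> h; split; [exact: (h true)|exact: (h false)].
Qed.

(** The product measure arises as the image of one uniform variable under the independent family of
    [unit_law_indep]. *)
Lemma iid_unit_law (R : realType) (V : countType) :
  exists P : probability (process V R) R,
  forall (F : seq V) (A : V -> set R), uniq F -> (forall v, measurable (A v)) ->
    P (rectangle F A) = (\prod_(v <- F) unit_law (A v))%E.
Proof.
have [Y [mY YE]] := @unit_law_indep R V.
have mf : measurable_fun [set: R] ((fun x v => Y v x) : R -> process V R).
  exact: measurable_fun_process.
have [P PE] := @pushforward_probability R _ _ _ _ (@unit_law R) _ mf.
by exists P => F A uF mA; rewrite PE -YE.
Qed.

(** * Quantile functions on a countable chain *)

Section countable_fibers.
Variables (R : realType) (S : Type).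
Hypothesis S_countable : countable [set: S].

Lemma countable_union_measurable d (X : sigmaRingType d) (F : S -> set X) :
  (forall s, measurable (F s)) -> measurable (\bigcup_s F s).
Proof.
move=> mF; have /countable_injP[f f_inj] := S_countable.
rewrite (_ : \bigcup_s F s = \bigcup_n \bigcup_(s in [set s | f s = n]) F s).
  apply: bigcup_measurable => n _.
  have [[s sn]|nos] := pselect (exists s, f s = n).
    rewrite (_ : \bigcup_(_ in _) _ = F s)//.
    apply/seteqP; split => [x [t /= tn]|x Fx]; last by exists s.
    by rewrite (f_inj t s) ?in_setT// tn.
  rewrite (_ : \bigcup_(_ in _) _ = set0)//.
  by apply/seteqP; split => // x [t tn _]; apply: nos; exists t.
by apply/seteqP; split => x [n]; [exists (f n) => //; exists n|move=> _ [s _ Fx]; exists s].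
Qed.

Lemma measure_fibers d (X : measurableType d) (m : {measure set X -> \bar R})
    (E : set X) (g : X -> S) (f : S -> nat) : injective f ->
  (forall s, measurable (E `&` [set x | g x = s])) ->
  m E = (\sum_(n <oo) m (E `&` [set x | f (g x) = n]))%E.
Proof.
move=> f_inj mE.
have mF n : measurable (E `&` [set x | f (g x) = n]).
  have [[s sn]|nos] := pselect (exists s, f s = n).
    rewrite (_ : [set x | _] = [set x | g x = s])//.
    by apply/seteqP; split => x /=; [rewrite -sn => /f_inj|move=> ->].
  rewrite (_ : E `&` _ = set0)//; apply/seteqP; split => // x [_ xn].
  by apply: nos; exists (g x).
have tF : trivIset setT (fun n => E `&` [set x | f (g x) = n]).
  by move=> i j _ _ [x [[_ /= <-] [_ /= <-]]].
rewrite -measure_semi_bigcup//; last exact: bigcup_measurable.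
congr (m _); apply/seteqP; split => x; last by case=> n _ [].
by move=> Ex; exists (f (g x)).
Qed.

Section compare.
Variables (d1 d2 : measure_display) (X1 : measurableType d1) (X2 : measurableType d2).
Variables (m1 : {measure set X1 -> \bar R}) (m2 : {measure set X2 -> \bar R}).
Variables (E1 : set X1) (E2 : set X2) (g1 : X1 -> S) (g2 : X2 -> S) (c : R).
Hypothesis c_ge0 : 0 <= c.
Hypothesis mE1 : forall s, measurable (E1 `&` [set x | g1 x = s]).
Hypothesis mE2 : forall s, measurable (E2 `&` [set x | g2 x = s]).

Let fiberE (Y : Type) (E : set Y) (g : Y -> S) (f : S -> nat) n : injective f ->
  (exists2 s, f s = n & E `&` [set x | f (g x) = n] = E `&` [set x | g x = s]) \/
  (forall s, f s <> n) /\ E `&` [set x | f (g x) = n] = set0.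
Proof.
move=> f_inj; have [[s <-]|nos] := pselect (exists s, f s = n); [left|right].
  exists s => //; congr (_ `&` _).
  by apply/seteqP; split => x /=; [move=> /f_inj|move=> ->].
split=> [s sn|]; first by apply: nos; exists s.
by apply/seteqP; split => // x [_ xn]; apply: nos; exists (g x).
Qed.

(** Inequalities on the fibres are summed over an enumeration of [S]. A bound on conditional
    probabilities given a discrete variable enters with [c] equal to the bound and [E2] the full
    space. *)
Lemma le_measure_fibers :
  (forall s, m1 (E1 `&` [set x | g1 x = s]) <=
             c%:E * m2 (E2 `&` [set x | g2 x = s]))%E ->
  (m1 E1 <= c%:E * m2 E2)%E.
Proof.
move=> h; have /countable_injP[f f_inj'] := S_countable.
have f_inj : injective f by move=> s t; apply: f_inj'; rewrite in_setT.
rewrite (measure_fibers m1 f_inj mE1) (measure_fibers m2 f_inj mE2).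
rewrite -nneseriesZl => [|n _]; last exact: measure_ge0.
apply: lee_nneseries => [n _ _|n _]; first exact: measure_ge0.
have [[s sn ->]|[nos ->]] := fiberE E1 g1 n f_inj; last first.
  have [[t /nos//]|[_ ->]] := fiberE E2 g2 n f_inj.
  by rewrite !measure0 mule0.
have [[t tn ->]|[/(_ s)]] := fiberE E2 g2 n f_inj; last by rewrite sn.
by have -> : t = s by apply: f_inj; rewrite tn.
Qed.

Lemma ge_measure_fibers :
  (forall s, c%:E * m2 (E2 `&` [set x | g2 x = s]) <=
             m1 (E1 `&` [set x | g1 x = s]))%E ->
  (c%:E * m2 E2 <= m1 E1)%E.
Proof.
move=> h; have /countable_injP[f f_inj'] := S_countable.
have f_inj : injective f by move=> s t; apply: f_inj'; rewrite in_setT.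
rewrite (measure_fibers m1 f_inj mE1) (measure_fibers m2 f_inj mE2).
rewrite -nneseriesZl => [|n _]; last exact: measure_ge0.
apply: lee_nneseries => [n _ _|n _]; first by rewrite mule_ge0.
have [[s sn ->]|[_ ->]] := fiberE E2 g2 n f_inj; last by rewrite measure0 mule0.
have [[t tn ->]|[/(_ s)]] := fiberE E1 g1 n f_inj; last by rewrite sn.
by have -> : t = s by apply: f_inj; rewrite tn.
Qed.

Lemma eq_measure_fibers :
  (forall s, m1 (E1 `&` [set x | g1 x = s]) =
             c%:E * m2 (E2 `&` [set x | g2 x = s]))%E ->
  m1 E1 = (c%:E * m2 E2)%E.
Proof.
move=> h; apply/eqP; rewrite eq_le; apply/andP; split.
  by apply: le_measure_fibers => s; rewrite h.
by apply: ge_measure_fibers => s; rewrite h.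
Qed.

End compare.
End countable_fibers.

(** * Jumps of the distribution function and quantiles *)

Section quantile.
Variables (R : realType) (disp : Order.disp_t) (S : tOrderType disp).
Implicit Types (m : set (spin S) -> \bar R) (s t : S) (u : R).

(** The jump of the distribution function at [s], laid out on the vertical axis; for a probability
    its length is the mass of [s]. *)
Definition jump m s : set R :=
  [set u | fine (m [set t | (t < s)%O]) <= u < fine (m [set t | (t <= s)%O])].

(* Off this set, which has full measure, the quantile takes the junk value \top:
   when S is order-dense a cut of S need not be realized by an element. *)
Definition regular m : set R := \bigcup_s jump m s.

Definition quantile m u : S := xget \top%O [set s | jump m s u].

Lemma regular_quantile m u : regular m u -> jump m (quantile m u) u.
Proof. by move=> [s _ su]; exact: (xgetPex \top%O (ex_intro (fun s => jump m s u) s su)). Qed.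

Variable P : probability (spin S) R.

Let le_P (A B : set (spin S)) : A `<=` B -> fine (P A) <= fine (P B).
Proof.
move=> AB; rewrite fine_le// ?fin_num_measure//.
by apply: le_measure => //; rewrite inE.
Qed.

(** If the quantile [t] for [m] were strictly below the quantile [s] for [P], then u < m(<= t) <=
    P(<= t) <= P(< s) <= u. Regularity for both measures supplies the two outer inequalities. *)
Lemma quantile_le m u :
  (forall s, m [set t | (t <= s)%O] <= P [set t | (t <= s)%O])%E ->
  (forall s, m [set t | (t <= s)%O] \is a fin_num) ->
  regular P u -> regular m u -> (quantile P u <= quantile m u)%O.
Proof.
move=> mP mfin /regular_quantile /andP[+ _] /regular_quantile/andP[_].
set s := quantile P u; set t := quantile m u => Pu um.
rewrite leNgt; apply/negP => ts; move: (lt_le_trans um (fine_le (mfin t)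
    (fin_num_measure P _ I) (mP t))).
apply/negP; rewrite -leNgt; apply: le_trans Pu.
by apply: le_P => r /= /le_lt_trans; apply.
Qed.

Lemma jump_unique s t u : jump P s u -> jump P t u -> s = t.
Proof.
have lt_jump a b : (a < b)%O -> jump P a u -> jump P b u -> False.
  move=> ab /andP[_ ua] /andP[bu _].
  have := lt_le_trans ua (le_P (B := [set r | (r < b)%O]) _).
  by rewrite ltNge bu => /(_ (fun r ra => le_lt_trans ra ab)).
by move=> su tu; case: (ltgtP s t) => // [/lt_jump|/lt_jump] => [/(_ su tu)|/(_ tu su)].
Qed.

Lemma quantile_eq s u : jump P s u -> quantile P u = s.
Proof. by move=> su; apply: xget_unique => // t tu; exact: jump_unique tu su. Qed.

Lemma measurable_jump m s : measurable (jump m s).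
Proof.
rewrite (_ : jump m s = `[fine (m [set t | (t < s)%O]), fine (m [set t | (t <=
    s)%O])[%classic)//.
Qed.

Lemma unit_law_jump s : unit_law (jump P s) = P [set s].
Proof.
have bounds A : 0 <= fine (P A) <= 1.
  rewrite fine_ge0//= -[1]/(fine 1%E) fine_le//; first exact: fin_num_measure.
  exact: probability_le1.
have /andP[h0 _] := bounds [set t | (t < s)%O].
have /andP[_ h1] := bounds [set t | (t <= s)%O].
rewrite unit_law_itv//; last by apply: le_P => r /ltW.
rewrite (_ : [set t | (t <= s)%O] = [set t | (t < s)%O] `|` [set s]); last first.
  apply/seteqP; split => r /=; rewrite le_eqVlt.
    by move=> /orP[/eqP|]; [right|left].
  by move=> [->|->]; rewrite ?eqxx ?orbT.
rewrite measureU//; last by apply/seteqP; split => r //= [+ rs]; rewrite rs ltxx.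
by rewrite fineD ?fin_num_measure// addrC addKr fineK// fin_num_measure.
Qed.

Hypothesis S_countable : countable [set: S].

Lemma measurable_regular m : measurable (regular m).
Proof.
by apply: countable_union_measurable => // s; exact: measurable_jump.
Qed.

(** The jumps are disjoint with lengths the masses of the points, and by countability these masses
    add up to 1, even when [S] is order-dense. *)
Lemma unit_law_regular : @unit_law R (regular P) = 1%E.
Proof.
apply/eqP; rewrite eq_le probability_le1/=; last exact: measurable_regular.
have mF s : measurable (regular P `&` [set u | quantile P u = s]).
  rewrite (_ : _ `&` _ = jump P s); first exact: measurable_jump.
  apply/seteqP; split => u /=; first by move=> [/regular_quantile + <-].
  by move=> su; split; [exists s|exact: quantile_eq].
rewrite -(probability_setT P) -[P setT]mul1e.
apply: (@ge_measure_fibers R S S_countable _ _ _ _ (@unit_law R) P _ _ (quantile P) id) => //.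
move=> s; rewrite mul1e setTI -[X in (P X <= _)%E]/[set s] -unit_law_jump.
apply: le_measure; rewrite ?inE//; first exact: measurable_jump.
by move=> u su; split; [exists s|exact: quantile_eq].
Qed.

Lemma measurable_quantile s : measurable [set u | quantile P u = s].
Proof.
rewrite (_ : [set u | _] =
  jump P s `|` (~` regular P `&` [set u | quantile P u = s])); last first.
  apply/seteqP; split => u /=.
    move=> us; have [/regular_quantile|] := pselect (regular P u); last by right.
    by rewrite us; left.
  by move=> [/quantile_eq|[]].
apply: measurableU; first exact: measurable_jump.
(* Off the regular set the quantile is [\top], so no other value receives anything from there. *)
have [->|/eqP s1] := eqVneq s (\top%O : S).
  rewrite (_ : _ `&` _ = ~` regular P); first by apply: measurableC; exact: measurable_regular.
  apply/seteqP; split => u /=; first by case.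
  move=> nu; split => //; apply: xgetPN => t tu; apply: nu; exists t => //.
rewrite (_ : _ `&` _ = set0)//.
apply/seteqP; split => u //= [nu us]; apply: s1; rewrite -us.
by apply: xgetPN => t tu; apply: nu; exists t.
Qed.

Lemma unit_law_quantile s : unit_law [set u | quantile P u = s] = P [set s].
Proof.
have mq := measurable_quantile.
rewrite -unit_law_jump; apply/eqP; rewrite eq_le; apply/andP; split; last first.
  apply: le_measure; rewrite ?inE//; first exact: measurable_jump.
  by move=> u su; exact: quantile_eq.
apply: (@le_trans _ _ (unit_law (jump P s `|` ~` regular P))).
  apply: le_measure; rewrite ?inE//.
    by apply: measurableU; [exact: measurable_jump|apply: measurableC; exact:
        measurable_regular].
  move=> u us; have [|] := pselect (regular P u); last by right.
  by move=> /regular_quantile; rewrite us; left.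
apply: le_trans (measureU2 _ _ _) _; first exact: measurable_jump.
  by apply: measurableC; exact: measurable_regular.
have r0 : @unit_law R (~` regular P) = 0%E.
  rewrite probability_setC; last exact: measurable_regular.
  by rewrite [X in (1 - X)%E]unit_law_regular subee.
by rewrite /= r0 adde0.
Qed.

End quantile.

(** * Sequential sampling in a finite volume *)

Lemma probability_setI_full (R : realType) d (X : measurableType d)
    (P : probability X R) (A B : set X) : measurable A -> measurable B ->
  P B = 1%E -> P (A `&` B) = P A.
Proof.
move=> mA mB B1.
have Bc : P (~` B) = 0%E by rewrite probability_setC// B1 subee.
rewrite -[in RHS](setIT A) -(setUv B) setIUr measureU; last 3 first.
- exact: measurableI.
- by apply: measurableI => //; exact: measurableC.
- by apply/seteqP; split => // x [[_ Bx] [_ /(_ Bx)]].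
rewrite [X in (_ + X)%E](_ : _ = 0%E) ?adde0//.
have mBc := measurableC mB.
by apply: (subset_measure0 (B := ~` B)) => //; exact: measurableI.
Qed.

Section config_updates.
Variables (V : countType) (disp : Order.disp_t) (S : tOrderType disp).
Notation Omega := (config V S).
Implicit Types (tau eta w : Omega) (v : V) (s : S) (vs : seq V).

Definition update tau v s : Omega := fun x => if x == v then s else tau x.

Lemma finite_perturb_update eta tau v s :
  finite_perturb eta tau -> finite_perturb eta (update tau v s).
Proof.
move=> h; apply: (sub_finite_set _ (_ : finite_set ([set x | tau x <> eta x] `|` [set v]))).
  move=> x /=; rewrite /update; case: eqP => [->|]; [by right|by left].
by rewrite finite_setU; split => //; exact: finite_set1.
Qed.

Lemma finite_perturb_refl eta : finite_perturb eta eta.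
Proof.
rewrite /finite_perturb/= (_ : [set v | _] = set0); first exact: finite_set0.
by apply/seteqP; split => x.
Qed.

(** A finite perturbation is encoded by the finite list of its deviations from [eta]. Countability
    allows the null sets attached to the individual boundary conditions to be united. *)
Lemma countable_finite_perturb eta : countable [set: S] ->
  exists tau_ : nat -> Omega, (forall n, finite_perturb eta (tau_ n)) /\
    forall tau, finite_perturb eta tau -> exists n, tau = tau_ n.
Proof.
move=> /countable_injP[f f_inj'].
have f_inj : injective f by move=> s t; apply: f_inj'; rewrite in_setT.
pose dec n : S := xget \top%O [set s | f s = n].
have decK s : dec (f s) = s.
  by apply: xget_unique => // t /= /f_inj.
pose conf (l : seq (V * nat)) := foldr (fun p tau => update tau p.1 (dec p.2)) eta l.
exists (fun n => if choice.unpickle n is Some l then conf l else eta); split.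
  move=> n; case: choice.unpickle => [l|]; last exact: finite_perturb_refl.
  elim: l => [|p l IH]; first exact: finite_perturb_refl.
  exact: finite_perturb_update.
move=> tau htau.
pose l := [seq (v, f (tau v)) | v <- fset_set [set v | tau v <> eta v]].
exists (choice.pickle l); rewrite choice.pickleK.
apply/funext => v.
have confE (r : seq V) : conf [seq (x, f (tau x)) | x <- r] v =
    if v \in r then tau v else eta v.
  elim: r => //= x r IH; rewrite /update inE; case: eqP => [->|_] //=.
rewrite confE in_fset_set//; case: ifPn => // /negP; rewrite inE => /contrapT.
by [].
Qed.

Lemma measurable_config_coord v (A : set S) : measurable [set w : Omega | A (w v)].
Proof. exact: (@measurable_coord V _ (spin S) v A). Qed.

Lemma measurable_frozen_off (A : set V) tau : measurable (frozen_off A tau).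
Proof.
rewrite (_ : frozen_off A tau = \bigcap_v [set w : Omega | ~ A v -> w v = tau v]).
  have h v : measurable [set w : Omega | ~ A v -> w v = tau v].
    exact: (measurable_config_coord v [set s | ~ A v -> s = tau v]).
  rewrite -[X in measurable X]setCK setC_bigcap; apply: measurableC.
  apply: countable_union_measurable => [|v]; last exact: measurableC.
  exact: countableP.
by apply/seteqP; split => [w h v _|w h v]; [exact: h|exact: (h v)].
Qed.

End config_updates.

(** * Domain Markov property and the sequential sampler *)

Section specification.
Variables (R : realType) (V : countType) (disp : Order.disp_t) (S : tOrderType disp).
Notation Omega := (config V S).
Implicit Types (rho : spec_family R V S) (tau eta w : Omega) (v : V) (s : S).
Implicit Types (vs : seq V) (A : set V) (B : set Omega).

(** The domain Markov property at one vertex. Changing [tau] at [v], inside [A], does not affect the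
    law, and after the change {w v = s} agrees almost surely with the event frozen off [A] minus
    [v], on which the specification prescribes the conditional law. If that event is null both sides
    vanish, so [s] is arbitrary. *)
Lemma specification_update rho eta A tau v s B :
  is_specification (finite_perturb eta) rho ->
  finite_set A -> A v -> finite_perturb eta tau -> measurable B ->
  rho A tau (B `&` [set w : Omega | w v = s]) =
  (rho A tau [set w : Omega | w v = s] * rho (A `\ v) (update tau v s) B)%E.
Proof.
move=> [hsupp hext hcond] fA Av htau mB.
have htau' := @finite_perturb_update V _ S eta tau v s htau.
have mv : measurable [set w : Omega | w v = s].
  exact: (@measurable_config_coord V _ S v [set s]).
have ext (C : set Omega) : measurable C -> rho A tau C = rho A (update tau v s) C.
  apply: hext => // x Ax; rewrite /update; case: eqP => // xv.
  by case: Ax; rewrite xv.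
set F := frozen_off (A `\ v) (update tau v s).
have mF : measurable F by exact: measurable_frozen_off.
have mG : measurable (frozen_off A (update tau v s)) by exact: measurable_frozen_off.
have fullE (C : set Omega) : measurable C ->
    rho A (update tau v s) (C `&` [set w : Omega | w v = s]) = rho A (update tau v s) (C `&` F).
  move=> mC; rewrite -(probability_setI_full (B := frozen_off A (update tau v s)))//;
    [|exact: measurableI|exact: hsupp].
  rewrite -[RHS](probability_setI_full (B := frozen_off A (update tau v s)))//;
    [|exact: measurableI|exact: hsupp].
  congr (rho A (update tau v s) _); apply/seteqP; split => w [[Cw h] hA]; split =>
      //; split => //.
    move=> x nAx; have [xv|/eqP xv] := eqVneq x v.
      by rewrite xv h /update eqxx.
    by apply: hA => Ax; apply: nAx; split.
  by rewrite /= (h v) /update ?eqxx// => -[_]; exact.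
rewrite !ext//; last exact: measurableI.
rewrite fullE// -[X in (rho A _ X * _)%E]setTI fullE// setTI.
have [F0|F0] := eqVneq (rho A (update tau v s) F) 0%E.
  rewrite F0 mul0e; apply: (subset_measure0 (B := F)) => //; exact: measurableI.
have Fgt0 : (0 < rho A (update tau v s) F)%E by rewrite lt0e F0 measure_ge0.
have := hcond (A `\ v) A (update tau v s) fA (@subDsetl _ _ _) htau' Fgt0 B mB.
rewrite /cond_prob -/F => h.
have finF : rho A (update tau v s) F \is a fin_num by rewrite fin_num_measure.
have fF0 : fine (rho A (update tau v s) F) != 0 by rewrite fine_eq0.
rewrite -[LHS]fineK ?fin_num_measure//; last exact: measurableI.
rewrite -[X in (X * _)%E]fineK// -[X in (_ * X)%E]fineK ?fin_num_measure//.
by rewrite -h -EFinM mulrCA divff// mulr1.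
Qed.

Lemma st_le_coord (P Q : probability Omega R) v s : st_le P Q ->
  (Q [set w : Omega | (w v <= s)%O] <= P [set w : Omega | (w v <= s)%O])%E.
Proof.
move=> PQ.
have mgt : measurable [set w : Omega | (s < w v)%O].
  exact: (@measurable_config_coord V _ S v [set t | (s < t)%O]).
have -> : [set w : Omega | (w v <= s)%O] = ~` [set w : Omega | (s < w v)%O].
  by apply/seteqP; split => w /=; rewrite leNgt => /negP.
rewrite !probability_setC// leeB//; apply: PQ => // w w' /= sw ww'.
exact: lt_le_trans sw (ww' v).
Qed.

Hypothesis S_countable : countable [set: S].

Let mfib B v s : measurable B -> measurable (B `&` [set w : Omega | w v = s]).
Proof.
move=> mB; apply: measurableI => //.
exact: (@measurable_config_coord V _ S v [set s]).
Qed.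

Let setU_consD (U : set V) r (rs : seq V) : r \notin rs -> ~ U r ->
  (U `|` [set x | x \in r :: rs]) `\ r = U `|` [set x | x \in rs].
Proof.
move=> rrs Ur; apply/seteqP; split => x /=.
  move=> [[Ux|xrs] xr]; [by left|right].
  by move: xrs; rewrite inE => /orP[/eqP/xr|].
move=> [Ux|xrs]; split.
- by left.
- by move=> xr; apply: Ur; rewrite -xr.
- by right; rewrite inE xrs orbT.
- by move=> xr; move: rrs; rewrite -xr xrs.
Qed.

Let finite_setU_seq (U : set V) (rs : seq V) :
  finite_set U -> finite_set (U `|` [set x | x \in rs]).
Proof. by move=> fU; rewrite finite_setU; split => //; exact: finite_seq. Qed.

(* The vertices of rs are removed one at a time: revealing the value at one of
   them turns the boundary value \top there into a smaller one. *)
Lemma st_le_shrink_top rho (U : set V) (rs : seq V) tau' tau :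
  is_specification (finite_perturb (top_config S)) rho ->
  monotone_spec (finite_perturb (top_config S)) rho ->
  finite_set U -> uniq rs -> (forall v, v \in rs -> ~ U v) ->
  finite_perturb (top_config S) tau -> finite_perturb (top_config S) tau' ->
  config_le tau' tau -> (forall v, v \in rs -> tau v = \top%O) ->
  st_le (rho (U `|` [set x | x \in rs]) tau') (rho U tau).
Proof.
move=> spec mono fU; elim: rs tau' => [|r rs IH] tau' /=.
  move=> _ _ htau htau' le _.
  rewrite (_ : [set x | _] = set0) ?setU0; last by apply/seteqP; split.
  exact: mono.
move=> /andP[rrs urs] Urs htau htau' le top B mB incB.
set A := U `|` _.
have fA : finite_set A by exact: finite_setU_seq.
have Ar : A r by right; rewrite /= inE eqxx.
have AD : A `\ r = U `|` [set x | x \in rs].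
  by apply: setU_consD => //; apply: Urs; rewrite inE eqxx.
have finB : rho U tau B \is a fin_num by rewrite fin_num_measure.
suff : (rho A tau' B <= (fine (rho U tau B))%:E * rho A tau' setT)%E.
  by rewrite probability_setT mule1 fineK.
apply: (@le_measure_fibers R S S_countable _ _ _ _ (rho A tau') (rho A tau') _ _
  (fun w => w r) (fun w => w r)) => [s|s|s]; [exact: mfib|exact: mfib|].
rewrite fineK// setTI /= (specification_update s spec)// muleC AD lee_wpmul2r//.
apply: IH => //.
- by move=> v vrs; apply: Urs; rewrite inE vrs orbT.
- exact: finite_perturb_update.
- move=> v; rewrite /update; case: eqP => [->|_]; last exact: le.
  by rewrite top ?lex1// inE eqxx.
- by move=> v vrs; apply: top; rewrite inE vrs orbT.
Qed.

(** Dual to [st_le_shrink_top]: [tau] is minimal on [rs], so any value revealed there keeps [tau']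
    above it. [Q] is arbitrary since only the upper law is disintegrated; in the application [Q] has
    a boundary condition of another class than [tau']. *)
Lemma st_le_grow rho (Q : probability Omega R) (U : set V) (rs : seq V) tau tau' :
  is_specification (finite_perturb (top_config S)) rho ->
  finite_set U -> uniq rs -> (forall v, v \in rs -> ~ U v) ->
  (forall v s, v \in rs -> (tau v <= s)%O) ->
  (forall tau', finite_perturb (top_config S) tau' -> config_le tau tau' ->
    st_le Q (rho U tau')) ->
  finite_perturb (top_config S) tau' -> config_le tau tau' ->
  st_le Q (rho (U `|` [set x | x \in rs]) tau').
Proof.
move=> spec fU + + + QU; elim: rs tau' => [|r rs IH] tau' /=.
  move=> _ _ _ htau' le.
  rewrite (_ : [set x | _] = set0) ?setU0; last by apply/seteqP; split.
  exact: QU.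
move=> /andP[rrs urs] Urs bot htau' le B mB incB.
set A := U `|` _.
have fA : finite_set A by exact: finite_setU_seq.
have Ar : A r by right; rewrite /= inE eqxx.
have AD : A `\ r = U `|` [set x | x \in rs].
  by apply: setU_consD => //; apply: Urs; rewrite inE eqxx.
have finB : Q B \is a fin_num by rewrite fin_num_measure.
suff : ((fine (Q B))%:E * rho A tau' setT <= rho A tau' B)%E.
  by rewrite probability_setT mule1 fineK.
apply: (@ge_measure_fibers R S S_countable _ _ _ _ (rho A tau') (rho A tau') _ _
  (fun w => w r) (fun w => w r)) => [|s|s|s]; [by rewrite fine_ge0|exact: mfib|exact: mfib|].
rewrite fineK// setTI /= (specification_update s spec)// muleC AD lee_wpmul2l//.
apply: IH => //.
- by move=> v vrs; apply: Urs; rewrite inE vrs orbT.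
- by move=> v t vrs; apply: bot; rewrite inE vrs orbT.
- exact: finite_perturb_update.
- move=> v; rewrite /update; case: eqP => [->|_]; last exact: le.
  by rewrite bot// inE eqxx.
Qed.

Lemma marginal_probability (P : probability Omega R) v :
  exists Q : probability (spin S) R, (Q : set (spin S) -> \bar R) = marginal P v.
Proof.
pose F : {mfun Omega >-> spin S} :=
  mfun_Sub (mem_set (@measurable_eval V _ (spin S) v)).
by exists (distribution P F).
Qed.

Lemma st_le_quantile (P Q : probability Omega R) v (u : R) : st_le P Q ->
  regular (marginal P v) u -> regular (marginal Q v) u ->
  (quantile (marginal P v) u <= quantile (marginal Q v) u)%O.
Proof.
move=> PQ; have [P' PE] := marginal_probability P v; rewrite -PE => rP rQ.
apply: quantile_le => // s; first by rewrite PE; exact: (st_le_coord v s PQ).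
have [Q' <-] := marginal_probability Q v.
by rewrite fin_num_measure.
Qed.

Definition quantile_update rho vs tau v (u : R) : Omega :=
  update tau v (quantile (marginal (rho [set a | a \in vs] tau) v) u).

(** The values sampled so far are stored in the boundary condition [tau]; [vs] lists the vertices
    still unrevealed. *)
Fixpoint sample rho vs tau (x : V -> R) : Omega :=
  if vs is v :: vs' then sample rho vs' (quantile_update rho vs tau v (x v)) x
  else tau.

(** Taken over all lists and boundary conditions, so that it applies at every step of every sample,
    whatever has been revealed. *)
Definition regular_uniforms rho eta (x : V -> R) :=
  forall vs v tau, finite_perturb eta tau ->
    regular (marginal (rho [set a | a \in vs] tau) v) (x v).

Lemma eq_in_sample rho vs tau (x x' : V -> R) : {in vs, x =1 x'} ->
  sample rho vs tau x = sample rho vs tau x'.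
Proof.
elim: vs tau => //= a vs IH tau xx'; rewrite xx' ?inE ?eqxx//.
by apply: IH => v vvs; apply: xx'; rewrite inE vvs orbT.
Qed.

Let split_filter (A : pred V) vs : [set x | x \in vs] =
  [set x | x \in seq.filter A vs] `|` [set x | x \in seq.filter (predC A) vs].
Proof.
apply/seteqP; split => x /=; rewrite !mem_filter/=.
  by case: (A x) => xvs; [left|right].
by case=> /andP[].
Qed.

(** The invariant is [tau'] below [tau]. At a vertex of [A] both sides insert the same uniform into
    stochastically ordered marginals; at any other vertex only [tau'] changes, and [tau] still has
    [\top] there. This last fact is also what [st_le_shrink_top] needs at each step. *)
Lemma sample_shrink_top rho vs (A : pred V) tau' tau (x : V -> R) :
  is_specification (finite_perturb (top_config S)) rho ->
  monotone_spec (finite_perturb (top_config S)) rho ->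
  regular_uniforms rho (top_config S) x -> uniq vs ->
  finite_perturb (top_config S) tau -> finite_perturb (top_config S) tau' ->
  config_le tau' tau -> (forall v, v \in vs -> ~~ A v -> tau v = \top%O) ->
  config_le (sample rho vs tau' x) (sample rho (seq.filter A vs) tau x).
Proof.
move=> spec mono reg; elim: vs tau' tau => [//|v vs IH] tau' tau /=.
move=> /andP[vvs uvs] htau htau' le top.
have dom : st_le (rho [set a | a \in v :: vs] tau')
                 (rho [set a | a \in seq.filter A (v :: vs)] tau).
  rewrite (split_filter A (v :: vs)); apply: st_le_shrink_top => //.
  - by rewrite filter_uniq//= vvs.
  - move=> a; rewrite mem_filter => /andP[/negbTE nA _].
    by rewrite (_ : [set` _] a = (a \in seq.filter A (v :: vs)))// mem_filter nA.
  - by move=> a; rewrite mem_filter => /andP[Aa avs]; exact: top.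
have top' a : a \in vs -> ~~ A a -> tau a = \top%O.
  by move=> avs; apply: top; rewrite inE avs orbT.
case: ifPn => Av; last first.
  apply: IH => //; first exact: finite_perturb_update.
  move=> a; rewrite /quantile_update /update; case: eqP => [->|_]; last exact: le.
  by rewrite top ?lex1// inE eqxx.
apply: IH => //; try exact: finite_perturb_update.
  move=> a; rewrite /quantile_update /update; case: eqP => [_|_]; last exact: le.
  have := st_le_quantile dom (reg _ v _ htau') (reg _ v _ htau).
  by rewrite /= Av.
move=> a avs Aa; rewrite /quantile_update /update; case: eqP => [av|_]; last exact: top'.
by move: vvs; rewrite -av avs.
Qed.

(** The same coupling with the roles exchanged: [tau] is minimal at the vertices outside [A], so an
    update of [tau'] there cannot break the order. *)
Lemma sample_grow rho vs (A : pred V) eta tau' tau (x : V -> R) :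
  is_specification (finite_perturb (top_config S)) rho ->
  (forall (B : set V) tau tau', finite_set B -> finite_perturb eta tau ->
    finite_perturb (top_config S) tau' -> config_le tau tau' ->
    st_le (rho B tau) (rho B tau')) ->
  regular_uniforms rho eta x -> regular_uniforms rho (top_config S) x -> uniq vs ->
  finite_perturb eta tau -> finite_perturb (top_config S) tau' ->
  config_le tau tau' -> (forall v s, v \in vs -> ~~ A v -> (tau v <= s)%O) ->
  config_le (sample rho (seq.filter A vs) tau x) (sample rho vs tau' x).
Proof.
move=> spec mono reg regT; elim: vs tau' tau => [//|v vs IH] tau' tau /=.
move=> /andP[vvs uvs] htau htau' le bot.
have dom : st_le (rho [set a | a \in seq.filter A (v :: vs)] tau)
                 (rho [set a | a \in v :: vs] tau').
  rewrite (split_filter A (v :: vs)); apply: (st_le_grow (tau := tau)) => //.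
  - by rewrite filter_uniq//= vvs.
  - move=> a; rewrite mem_filter => /andP[/negbTE nA _].
    by rewrite (_ : [set` _] a = (a \in seq.filter A (v :: vs)))// mem_filter nA.
  - by move=> a s; rewrite mem_filter => /andP[Aa avs]; exact: bot.
  - by move=> tau'' h1 h2; apply: mono => //; exact: finite_seq.
have bot' a s : a \in vs -> ~~ A a -> (tau a <= s)%O.
  by move=> avs; apply: bot; rewrite inE avs orbT.
case: ifPn => Av; last first.
  apply: IH => //; first exact: finite_perturb_update.
  move=> a; rewrite /quantile_update /update; case: eqP => [->|_]; last exact: le.
  by rewrite bot// inE eqxx.
apply: IH => //; try exact: finite_perturb_update.
  move=> a; rewrite /quantile_update /update; case: eqP => [_|_]; last exact: le.
  have := st_le_quantile dom (reg _ v _ htau) (regT _ v _ htau').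
  by rewrite /= Av.
move=> a s avs Aa; rewrite /quantile_update /update; case: eqP => [av|_]; last exact: bot'.
by move: vvs; rewrite -av avs.
Qed.

End specification.

(** * Samples in nested finite volumes *)

Section sampled_field.
Variables (R : realType) (V : countType) (disp : Order.disp_t) (S : tOrderType disp).
Notation Omega := (config V S).
Implicit Types (rho : spec_family R V S) (eta : Omega) (A : {fset V}).
Implicit Types (z x : V -> R).

(* Ties are broken by the numbering of V, which is not invariant under the
   group; they occur with probability 0. *)
Definition earlier z (a b : V) : bool :=
  (z a < z b) || (z a == z b) && (choice.pickle a <= choice.pickle b)%N.

Lemma earlier_total z : total (earlier z).
Proof.
move=> a b; rewrite /earlier; case: (ltgtP (z a) (z b)) => //= _.
exact: leq_total.
Qed.

Lemma earlier_trans z : transitive (earlier z).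
Proof.
move=> b a c; rewrite /earlier => /orP[ab|/andP[/eqP -> ab]] /orP[bc|/andP[/eqP <- bc]].
- by rewrite (lt_trans ab bc).
- by rewrite ab.
- by rewrite bc.
- by rewrite eqxx (leq_trans ab bc) orbT.
Qed.

Lemma earlier_anti z : antisymmetric (earlier z).
Proof.
move=> a b; rewrite /earlier; case: (ltgtP (z a) (z b)) => //= _.
by rewrite -eqn_leq => /eqP/(pcan_inj choice.pickleK).
Qed.

Definition sampling_order z A : seq V := sort (earlier z) A.

Definition sampled_field rho eta A z x : Omega := sample rho (sampling_order z A) eta x.

Lemma mem_sampling_order z A : sampling_order z A =i A.
Proof. by move=> v; rewrite mem_sort. Qed.

Lemma sampling_order_uniq z A : uniq (sampling_order z A).
Proof. by rewrite sort_uniq fset_uniq. Qed.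

Lemma sampling_orderS z A A' : (A `<=` A')%fset ->
  sampling_order z A = seq.filter (mem A) (sampling_order z A').
Proof.
move=> AA'; rewrite /sampling_order filter_sort; [|exact: earlier_total|exact: earlier_trans].
apply/perm_sortP; [exact: earlier_total|exact: earlier_trans|exact: earlier_anti|].
apply: uniq_perm; [exact: fset_uniq|exact/filter_uniq/fset_uniq|].
move=> v; rewrite mem_filter /=; apply/idP/andP => [vA|[]//].
by split => //; exact: (fsubsetP AA').
Qed.

(** Locality of the sample, from which the bound on the coding radius derives. *)
Lemma eq_in_sampled_field rho eta A z z' x x' : {in A, z =1 z'} -> {in A, x =1 x'} ->
  sampled_field rho eta A z x = sampled_field rho eta A z' x'.
Proof.
move=> zz' xx'; rewrite /sampled_field (_ : sampling_order z A = sampling_order z' A).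
  by apply: eq_in_sample => v; rewrite mem_sampling_order; exact: xx'.
apply: (sorted_eq (@earlier_trans z) (@earlier_anti z)).
- exact/sort_sorted/earlier_total.
- rewrite (@eq_in_sorted _ (mem A) _ (earlier z')); first exact/sort_sorted/earlier_total.
    by move=> a b aA bA; rewrite /earlier !zz'.
  by apply/allP => a; rewrite mem_sampling_order.
- by rewrite perm_sort perm_sym perm_sort.
Qed.

Hypothesis S_countable : countable [set: S].

Lemma sampled_field_shrink_top rho A A' z x :
  is_specification (finite_perturb (top_config S)) rho ->
  monotone_spec (finite_perturb (top_config S)) rho ->
  regular_uniforms rho (top_config S) x -> (A `<=` A')%fset ->
  config_le (sampled_field rho (top_config S) A' z x) (sampled_field rho (top_config S) A z x).
Proof.
move=> spec mono reg AA'; rewrite /sampled_field (sampling_orderS z AA').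
have h := finite_perturb_refl (top_config S : Omega).
by apply: sample_shrink_top => //; exact: sampling_order_uniq.
Qed.

Lemma sampled_field_grow rho eta A A' z x :
  is_specification (finite_perturb (top_config S)) rho ->
  (forall (B : set V) tau tau', finite_set B -> finite_perturb eta tau ->
    finite_perturb (top_config S) tau' -> config_le tau tau' ->
    st_le (rho B tau) (rho B tau')) ->
  regular_uniforms rho eta x -> regular_uniforms rho (top_config S) x ->
  (forall v s, (eta v <= s)%O) -> (A `<=` A')%fset ->
  config_le (sampled_field rho eta A z x) (sampled_field rho (top_config S) A' z x).
Proof.
move=> spec mono reg regT bot AA'; rewrite /sampled_field (sampling_orderS z AA').
have h := finite_perturb_refl (top_config S : Omega).
have h' := finite_perturb_refl eta.
by apply: (sample_grow S_countable spec mono) => //; exact: sampling_order_uniq.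
Qed.

End sampled_field.

(** * Equivariance and law of the sample *)

Section equivariance.
Variables (R : realType) (V : countType) (disp : Order.disp_t) (S : tOrderType disp).
Variables (Gamma : groupType) (act : Gamma -> V -> V).
Hypothesis actP : is_left_action act.
Variables (rho : spec_family R V S) (eta : config V S).
Hypothesis rho_inv : invariant_spec act (finite_perturb eta) rho.

Let actK g : cancel (act g) (act g^-1%g).
Proof. by move=> v; rewrite -actP.2 mulVg actP.1. Qed.

Let actVK g : cancel (act g^-1%g) (act g).
Proof. by move=> v; rewrite -actP.2 mulgV actP.1. Qed.

Let act_configE (T : Type) g (y : V -> T) v : act_config act g y (act g v) = y v.
Proof. by rewrite /act_config actK. Qed.

Lemma act_config_update g (tau : config V S) v s :
  update (act_config act g tau) (act g v) s = act_config act g (update tau v s).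
Proof.
by apply/funext => x; rewrite /act_config /update -(inj_eq (can_inj (actVK g)) x) actK.
Qed.

Lemma act_config_sample g (vs : seq V) tau (x : V -> R) : finite_perturb eta tau ->
  sample rho (map (act g) vs) (act_config act g tau) (act_config act g x) =
  act_config act g (sample rho vs tau x).
Proof.
elim: vs tau => //= v vs IH tau htau.
rewrite act_configE -IH; last exact: finite_perturb_update.
congr (sample _ _ _ _); rewrite /quantile_update -act_config_update.
congr (update _ _ (quantile _ _)); apply/funext => X; rewrite /marginal /pushforward.
rewrite -(rho_inv g (finite_seq (v :: vs)) htau) /=; last exact: measurable_config_coord.
have -> : [set` act g v :: [seq act g i | i <- vs]] = act g @` [set` v :: vs].
  apply/seteqP; split => a /=.
    by rewrite -map_cons => /mapP[b bvs ->]; exists b.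
  by move=> [b bvs <-]; rewrite -map_cons; exact: map_f.
congr (rho _ _ _); apply/seteqP; split => w /=; by rewrite /act_config invgK.
Qed.

(** With injective [z] the numbering of [V] is consulted only to compare a vertex with itself, so
    [g] carries one sampling order to the other. *)
Lemma act_config_sampled_field g (A : {fset V}) (z x : V -> R) : injective z ->
  act_config act g eta = eta ->
  sampled_field rho eta (act g @` A)%fset (act_config act g z) (act_config act g x) =
  act_config act g (sampled_field rho eta A z x).
Proof.
move=> z_inj eta_inv; rewrite /sampled_field -act_config_sample; last exact:
    finite_perturb_refl.
rewrite eta_inv; congr (sample _ _ _ _).
apply: (sorted_eq (@earlier_trans _ _ (act_config act g z)) (@earlier_anti _ _ _)).
- exact/sort_sorted/earlier_total.
- rewrite sorted_map (@eq_sorted _ _ (earlier z)); first exact/sort_sorted/earlier_total.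
  move=> a b; rewrite /= /earlier !act_configE; case: (eqVneq (z a) (z b)) => //=.
  by move=> /z_inj ->; rewrite !leqnn.
- apply: uniq_perm; first exact: sampling_order_uniq.
    by rewrite map_inj_uniq ?sampling_order_uniq//; exact: can_inj (actK g).
  move=> a; rewrite mem_sampling_order; apply/imfsetP/mapP.
    by move=> [b bA ->]; exists b; rewrite ?mem_sampling_order.
  by move=> [b]; rewrite mem_sampling_order => bA ->; exists b.
Qed.

End equivariance.

(** * Law of the sample in a finite volume *)

Section law.
Variables (R : realType) (V : countType) (disp : Order.disp_t) (S : tOrderType disp).
Notation Omega := (config V S).
Hypothesis S_countable : countable [set: S].
Variables (dOm : measure_display) (Om : measurableType dOm) (P : probability Om R).
Variables (z x : Om -> V -> R).
Hypothesis mz : measurable_fun [set: Om] (z : Om -> process V R).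
Hypothesis mx : forall v, measurable_fun [set: Om] (fun y => x y v).
Hypothesis zx_indep : forall (vs : seq V) (J : V -> set R) (B : set (process V R)),
  uniq vs -> (forall v, measurable (J v)) -> measurable B ->
  P ([set y | B (z y)] `&` [set y | forall v, v \in vs -> J v (x y v)]) =
  (P [set y | B (z y)] * \prod_(v <- vs) unit_law (J v))%E.
Variables (rho : spec_family R V S) (eta : Omega).
Hypothesis spec : is_specification (finite_perturb eta) rho.

(** [E] stands for the history, that is, the order and the values already revealed; the uniforms
    still to be used are independent of it. *)
Definition indep_uniforms (E : set Om) (vs : seq V) :=
  forall J : V -> set R, (forall v, measurable (J v)) ->
  P (E `&` [set y | forall v, v \in vs -> J v (x y v)]) =
  (P E * \prod_(v <- vs) unit_law (J v))%E.

Lemma indep_uniforms_cons (E : set Om) v (vs : seq V) (I : set R) : v \notin vs ->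
  measurable I -> indep_uniforms E (v :: vs) ->
  P (E `&` [set y | I (x y v)]) = (P E * unit_law I)%E /\
  indep_uniforms (E `&` [set y | I (x y v)]) vs.
Proof.
move=> vvs mI indep.
have {}indep J : (forall u, measurable (J u)) ->
    P (E `&` [set y | I (x y v)] `&` [set y | forall u, u \in vs -> J u (x y u)]) =
    (P E * unit_law I * \prod_(u <- vs) unit_law (J u))%E.
  move=> mJ; pose J' u := if u == v then I else J u.
  have J'E u : u \in vs -> J' u = J u.
    by rewrite /J'; case: eqP => // -> h; move: vvs; rewrite h.
  have J'v : J' v = I by rewrite /J' eqxx.
  have mJ' u : measurable (J' u) by rewrite /J'; case: ifP.
  have := indep J' mJ'; rewrite big_cons J'v (eq_big_seq (fun u => unit_law (J u))).
    rewrite muleA => <-; rewrite -setIA; congr (P (_ `&` _)); apply/seteqP; split => y /=.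
      move=> [Iy Jy] u; rewrite inE => /orP[/eqP ->|uvs]; first by rewrite J'v.
      by rewrite J'E//; exact: Jy.
    move=> h; split; first by rewrite -J'v; apply: h; rewrite inE eqxx.
    by move=> u uvs; rewrite -J'E//; apply: h; rewrite inE uvs orbT.
  by move=> u uvs; rewrite J'E.
have PE : P (E `&` [set y | I (x y v)]) = (P E * unit_law I)%E.
  have := indep (fun=> setT) (fun=> measurableT).
  rewrite big1 ?mule1 => [<-|u _]; last exact: probability_setT.
  by congr (P _); apply/seteqP; split => y //= -[].
by split => // J mJ; rewrite indep// PE.
Qed.

Lemma measurable_sample (vs : seq V) tau (B : set Omega) : measurable B ->
  measurable [set y | B (sample rho vs tau (x y))].
Proof.
elim: vs tau => [|v vs IH] tau mB /=.
  have [Bt|nB] := pselect (B tau).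
    by rewrite (_ : [set _ | _] = setT) //; apply/seteqP; split.
  by rewrite (_ : [set _ | _] = set0) //; apply/seteqP; split.
set q := quantile (marginal (rho [set` v :: vs] tau) v).
rewrite (_ : [set _ | _] = \bigcup_s ([set y | q (x y v) = s] `&`
   [set y | B (sample rho vs (update tau v s) (x y))])); last first.
  by apply/seteqP; split => [y By|y [s _ [/= <-]]] //; exists (q (x y v)).
apply: countable_union_measurable => // s; apply: measurableI; last exact: IH.
have [Q QE] := marginal_probability (rho [set` v :: vs] tau) v.
apply: (measurable_preimageT (mx v) (A := [set u | q u = s])).
by rewrite /q -QE; exact: measurable_quantile.
Qed.

(** The induction runs over all histories [E]. Splitting by the value [s] produced at [v], the new
    uniform contributes exactly the marginal mass of [s], the history is refined by this value, and
    [specification_update] reassembles the law. In the empty volume the law is the point mass at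
    [tau]. *)
Lemma sample_law (vs : seq V) tau (E : set Om) (B : set Omega) :
  uniq vs -> finite_perturb eta tau -> measurable E -> indep_uniforms E vs ->
  measurable B ->
  P (E `&` [set y | B (sample rho vs tau (x y))]) =
  (P E * rho [set` vs] tau B)%E.
Proof.
move=> + + + + mB; elim: vs tau E => [|v vs IH] tau E /=.
  move=> _ htau mE _; have [hsupp _ _] := spec.
  have tau1 : rho [set` [::]] tau [set tau] = 1%E.
    rewrite -(hsupp [set` [::]] tau) ?finite_seq//; congr (rho _ _ _).
    apply/seteqP; split => [w -> //|w h]; apply/funext => v; exact: h.
  have mtau : measurable ([set tau] : set Omega).
    rewrite (_ : [set tau] = frozen_off set0 tau); first exact: measurable_frozen_off.
    by apply/seteqP; split => [w -> //|w h]; apply/funext => v; apply: h => -[].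
  have [Bt|nB] := pselect (B tau).
    rewrite (_ : [set _ | _] = setT) ?setIT; last by apply/seteqP; split.
    suff -> : rho [set` [::]] tau B = 1%E by rewrite mule1.
    apply/eqP; rewrite eq_le probability_le1//= -tau1.
    by apply: le_measure; rewrite ?inE// => w ->.
  rewrite (_ : [set _ | _] = set0) ?setI0 ?measure0; last by apply/seteqP; split.
  suff -> : rho [set` [::]] tau B = 0%E by rewrite mule0.
  rewrite -(probability_setI_full mB mtau tau1) (_ : _ `&` _ = set0) ?measure0//.
  by apply/seteqP; split => // w [Bw wt]; apply: nB; rewrite -wt.
move=> /andP[vvs uvs] htau mE indep.
set A := [set` v :: vs]; set q := quantile (marginal (rho A tau) v).
have [Q QE] := marginal_probability (rho A tau) v.
have mq s : measurable [set u | q u = s] by rewrite /q -QE; exact: measurable_quantile.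
have mqx s : measurable [set y | q (x y v) = s].
  exact: (measurable_preimageT (mx v) (mq s)).
have ->: P E = (fine (P E))%:E by rewrite fineK// fin_num_measure.
have fA : finite_set A by exact: finite_seq.
have mEB : measurable (E `&` [set y | B (sample rho (v :: vs) tau (x y))]).
  by apply: measurableI => //; exact: measurable_sample.
apply: (@eq_measure_fibers R S S_countable _ _ _ _ P (rho A tau) _ _
  (fun y => q (x y v)) (fun w => w v)) => [|s|s|s].
- by rewrite fine_ge0.
- exact: measurableI.
- by apply: measurableI => //; exact: (@measurable_config_coord V _ S v [set s]).
rewrite /= (specification_update s spec)//; last by rewrite /A/= inE eqxx.
have [PEs indep'] := indep_uniforms_cons vvs (mq s) indep.
rewrite (_ : A `\ v = [set` vs]); last first.
  apply/seteqP; split => a; rewrite /A /= inE.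
    by move=> [/orP[/eqP//|]].
  by move=> avs; split; [rewrite avs orbT|move=> av; move: vvs; rewrite -av avs].
transitivity (P ((E `&` [set y | q (x y v) = s]) `&`
    [set y | B (sample rho vs (update tau v s) (x y))])).
  congr (P _); apply/seteqP; split => y /=.
    by move=> [[Ey By] qs]; split => //; move: By; rewrite /quantile_update -/A -/q qs.
  by move=> [[Ey qs] By]; split => //; split => //; rewrite /quantile_update -/A -/q qs.
rewrite IH//; [|exact: finite_perturb_update|exact: measurableI].
rewrite PEs muleA fineK ?fin_num_measure//; congr (_ * _ * _)%E.
by rewrite /q -QE unit_law_quantile// QE.
Qed.

Lemma measurable_earlier (a b : V) : measurable [set y : process V R | earlier y a b].
Proof.
have mv (c : V) := @measurable_eval V _ R c.
apply: (measurable_preimageT (f := fun y : process V R => earlier y a b) (A := [set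
    true])) => //.
apply: measurable_or; first exact: measurable_fun_ltr.
by apply: measurable_and => //; exact: measurable_fun_eqr.
Qed.

Lemma measurable_sampling_order (A : {fset V}) (vs : seq V) :
  measurable [set y : process V R | sampling_order y A = vs].
Proof.
have [pA|npA] := boolP (perm_eq A vs); last first.
  rewrite (_ : [set _ | _] = set0)//; apply/seteqP; split => // y yvs; apply: (negP npA).
  by rewrite -yvs perm_sym perm_sort.
rewrite (_ : [set _ | _] = [set y : process V R | sorted (earlier y) vs]); last first.
  apply/seteqP; split => y /=; first by move=> <-; exact/sort_sorted/earlier_total.
  move=> svs; apply: (sorted_eq (@earlier_trans _ _ y) (@earlier_anti _ _ y)) => //.
    exact/sort_sorted/earlier_total.
  by rewrite perm_sort.
case: vs {pA} => [|a vs].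
  by rewrite (_ : [set _ | _] = setT)//; apply/seteqP; split.
elim: vs a => [|b vs IH] a /=.
  by rewrite (_ : [set _ | _] = setT)//; apply/seteqP; split.
rewrite (_ : [set _ | _] = [set y : process V R | earlier y a b] `&`
  [set y : process V R | sorted (earlier y) (b :: vs)]).
  by apply: measurableI; [exact: measurable_earlier|exact: IH].
by apply/seteqP; split => y /=; [move/andP|move=> h; apply/andP].
Qed.

Let measurable_order A (vs : seq V) : measurable [set y | sampling_order (z y) A = vs].
Proof. exact: (measurable_preimageT mz (measurable_sampling_order A vs)). Qed.

Let field_fiber A (vs : seq V) (B : set Omega) :
  [set y | B (sampled_field rho eta A (z y) (x y))] `&` [set y | sampling_order (z y) A = vs] =
  [set y | sampling_order (z y) A = vs] `&` [set y | B (sample rho vs eta (x y))].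
Proof.
apply/seteqP; split => y /=; rewrite /sampled_field; first by move=> [By <-].
by move=> [<- By].
Qed.

Let measurable_sampled_field_fiber A (vs : seq V) (B : set Omega) : measurable B ->
  measurable ([set y | B (sampled_field rho eta A (z y) (x y))] `&`
              [set y | sampling_order (z y) A = vs]).
Proof.
move=> mB; rewrite field_fiber; apply: measurableI; first exact: measurable_order.
exact: measurable_sample.
Qed.

Lemma measurable_sampled_field A (B : set Omega) : measurable B ->
  measurable [set y | B (sampled_field rho eta A (z y) (x y))].
Proof.
move=> mB; rewrite (_ : [set _ | _] = \bigcup_vs
  ([set y | B (sampled_field rho eta A (z y) (x y))] `&` [set y | sampling_order (z
      y) A = vs])).
  apply: countable_union_measurable => [|vs]; [exact: countableP|].
  exact: measurable_sampled_field_fiber.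
by apply/seteqP; split => [y By|y [vs _ []]//]; exists (sampling_order (z y) A).
Qed.

(** Conditionally on the order, which depends on the priorities only, [sample_law] gives the same
    law whatever the order is. *)
Lemma sampled_field_law (A : {fset V}) (B : set Omega) : measurable B ->
  P [set y | B (sampled_field rho eta A (z y) (x y))] = rho [set` A] eta B.
Proof.
move=> mB; have h := finite_perturb_refl eta.
have fB : rho [set` A] eta B \is a fin_num by rewrite fin_num_measure.
transitivity ((fine (rho [set` A] eta B))%:E * P setT)%E; last first.
  by rewrite probability_setT mule1 fineK.
apply: (@eq_measure_fibers R (seq V) _ _ _ _ _ P P _ _
  (fun y => sampling_order (z y) A) (fun y => sampling_order (z y) A)) => [||vs|vs|vs].
- exact: countableP.
- by rewrite fine_ge0.
- exact: measurable_sampled_field_fiber.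
- by rewrite setTI; exact: measurable_order.
rewrite /= setTI field_fiber fineK//.
have [pA|npA] := boolP (perm_eq A vs); last first.
  rewrite (_ : [set y | sampling_order (z y) A = vs] = set0).
    by rewrite set0I !measure0 mule0.
  apply/seteqP; split => // y yvs; apply: (negP npA).
  by rewrite -yvs perm_sym perm_sort.
have uvs : uniq vs by rewrite -(perm_uniq pA) fset_uniq.
rewrite sample_law// => [|J mJ].
  rewrite muleC; congr (rho _ _ _ * _)%E.
  by apply/seteqP; split => a /=; rewrite -(perm_mem pA).
rewrite (zx_indep (B := [set y | sampling_order y A = vs]))//.
exact: measurable_sampling_order.
Qed.

End law.

(** * Priorities and uniform variables *)

Lemma probability_bigcap (R : realType) d (X : measurableType d)
    (P : probability X R) (I : countType) (F : I -> set X) :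
  (forall i, measurable (F i)) -> (forall i, P (F i) = 1%E) ->
  measurable (\bigcap_i F i) /\ P (\bigcap_i F i) = 1%E.
Proof.
move=> mF F1.
have mC : measurable (\bigcup_i ~` F i).
  apply: countable_union_measurable => [|i]; [exact: countableP|exact: measurableC].
have mI : measurable (\bigcap_i F i).
  by rewrite -[X in measurable X]setCK setC_bigcap; exact: measurableC.
split => //.
have C0 : P (\bigcup_i ~` F i) = 0%E.
  apply/eqP; rewrite eq_le measure_ge0 andbT.
  pose G n := if @choice.unpickle I n is Some i then ~` F i else set0.
  have mG n : measurable (G n).
    by rewrite /G; case: choice.unpickle => // i; exact: measurableC.
  have G0 n : P (G n) = 0%E.
    rewrite /G; case: choice.unpickle => [i|]; last exact: measure0.
    by rewrite probability_setC// F1 subee.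
  have sub : \bigcup_i ~` F i `<=` \bigcup_n G n.
    by move=> x [i _ Fx]; exists (choice.pickle i) => //; rewrite /G choice.pickleK.
  apply: le_trans (measure_sigma_subadditive P mG mC sub) _.
  by rewrite eseries0// => n _ _; exact: G0.
by rewrite -[X in P X]setCK setC_bigcap probability_setC// C0 sube0.
Qed.

Section randomness.
Variables (R : realType) (V : countType).

Lemma floor_fiber (n : nat) (k : int) :
  [set t : R | Num.floor (n.+1%:R * t) = k] =
  `[k%:~R / n.+1%:R, (k + 1)%:~R / n.+1%:R[%classic.
Proof.
have n0 : 0 < n.+1%:R :> R by rewrite ltr0n.
apply/seteqP; split => t /=; rewrite in_itv/=.
  move=> tk; rewrite ler_pdivrMr// ltr_pdivlMr// mulrC.
  by have := floor_itv (n.+1%:R * t); rewrite tk.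
by rewrite ler_pdivrMr// ltr_pdivlMr// mulrC => tk; exact/floor_def.
Qed.

Lemma measurable_floor_fiber (n : nat) (k : int) :
  measurable [set t : R | Num.floor (n.+1%:R * t) = k].
Proof. by rewrite floor_fiber. Qed.

Lemma unit_law_floor (n : nat) (k : int) :
  (unit_law [set t : R | Num.floor (n.+1%:R * t) = k] <= (n.+1%:R^-1)%:E)%E.
Proof.
have -> : (n.+1%:R^-1)%:E =
    lebesgue_measure (`[k%:~R / n.+1%:R, (k + 1)%:~R / n.+1%:R[%classic : set R).
  rewrite lebesgue_measure_itv/= lte_fin ltr_pM2r ?invr_gt0// ltr_int ltrDl ltr01.
  by rewrite -EFinB -mulrBl -intrB addrAC subrr add0r mul1r.
rewrite /unit_law floor_fiber; apply: le_measure; rewrite ?inE//.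
exact: measurableI.
Qed.

(** [w] and [u] split the real at each vertex into a priority and a uniform. Independence of the
    uniforms from the whole priority field is checked on rectangles and extended by
    [process_law_unique]; almost surely no two priorities coincide. *)
Lemma iid_priorities_uniforms :
  exists (P : probability (process V R) R) (w u : R -> R),
  [/\ iid P,
   measurable_fun setT (fun y : process V R => (fun v => w (y v)) : process V R),
   forall v, measurable_fun setT (fun y : process V R => u (y v)),
   forall (vs : seq V) (J : V -> set R) (B : set (process V R)),
     uniq vs -> (forall v, measurable (J v)) -> measurable B ->
     P ([set y | B (fun v => w (y v))] `&`
        [set y | forall v, v \in vs -> J v (u (y v))]) =
     (P [set y | B (fun v => w (y v))] * \prod_(v <- vs) unit_law (J v))%E
   & measurable [set y : process V R | injective (fun v => w (y v))] /\
     P [set y : process V R | injective (fun v => w (y v))] = 1%E].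
Proof.
have [P PE] := iid_unit_law R V.
have [w [u [mw mu wu]]] := @unit_law_split R.
have mwv v : measurable_fun setT (fun y : process V R => w (y v)).
  exact: (measurableT_comp mw (@measurable_eval V _ R v)).
have muv v : measurable_fun setT (fun y : process V R => u (y v)).
  exact: (measurableT_comp mu (@measurable_eval V _ R v)).
have mz : measurable_fun setT (fun y : process V R => (fun v => w (y v)) : process V R).
  exact: measurable_fun_process.
have mpre (f : R -> R) A : measurable_fun setT f -> measurable A -> measurable (f @^-1` A).
  exact: measurable_preimageT.
have wE A : measurable A -> unit_law (w @^-1` A) = unit_law A.
  move=> mA; have := wu A setT mA measurableT.
  by rewrite preimage_setT setIT [unit_law setT]probability_setT mule1.
have uE A : measurable A -> unit_law (u @^-1` A) = unit_law A.
  move=> mA; have := wu setT A measurableT mA.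
  by rewrite preimage_setT setTI [unit_law setT]probability_setT mul1e.
(* Padding with trivial constraints writes rectangles over different lists as products over a common
   list [K], where they can be multiplied factor by factor. *)
have PE_sub (F K : seq V) (A : V -> set R) : uniq K -> {subset F <= K} ->
    (forall v, measurable (A v)) ->
    P (rectangle F A) = (\prod_(v <- K) if v \in F then unit_law (A v) else 1)%E.
  move=> uK FK mA; rewrite (_ : rectangle F A =
      rectangle K (fun v => if v \in F then A v else setT)); last first.
    apply/seteqP; split => y /= h v.
      by move=> _; case: ifPn => // vF; exact: h.
    by move=> vF; have := h v (FK _ vF); rewrite vF.
  rewrite PE//; last by move=> v; case: ifP.
  by apply: eq_bigr => v _; case: ifP => // _; exact: probability_setT.
have iidP : iid P.
  split.
    move=> a b A mA.
    have h c : P [set y : process V R | A (y c)] = unit_law A.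
      have := PE [:: c] (fun=> A) isT (fun=> mA).
      rewrite big_cons big_nil mule1 => <-; congr (P _); apply/seteqP; split => y /=.
        by move=> Ay d; rewrite inE => /eqP ->.
      by apply; rewrite inE.
    by rewrite !h.
  move=> F A mA; rewrite (PE F A (fset_uniq F) mA); apply: eq_bigr => v _.
  have := PE [:: v] A isT mA.
  rewrite big_cons big_nil mule1 => <-; congr (P _); apply/seteqP; split => y /=.
    by apply; rewrite inE.
  by move=> Ay c; rewrite inE => /eqP ->.
have indep (vs : seq V) (J : V -> set R) (B : set (process V R)) :
     uniq vs -> (forall v, measurable (J v)) -> measurable B ->
     P ([set y | B (fun v => w (y v))] `&`
        [set y | forall v, v \in vs -> J v (u (y v))]) =
     (P [set y | B (fun v => w (y v))] * \prod_(v <- vs) unit_law (J v))%E.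
  move=> uvs mJ mB.
  pose E : set (process V R) := rectangle vs (fun v => u @^-1` J v).
  have mE : measurable E by apply: measurable_rectangle => v; exact: mpre.
  have EE : P E = (\prod_(v <- vs) unit_law (J v))%E.
    rewrite PE//; last by move=> v; exact: mpre.
    by apply: eq_bigr => v _; exact: uE.
  have [Q QE] := pushforward_probability P mz.
  have finE : P E \is a fin_num by rewrite fin_num_measure.
  rewrite muleC -EE setIC -[X in (_ = _ * X)%E](QE B) -[X in (_ = X * _)%E]fineK//.
  apply: (@process_law_unique R V _ R _ _ P E _ _ Q mE mz _ _ B mB).
    by rewrite fine_ge0.
  move=> F A mA; rewrite fineK// /= QE.
  pose K := undup (vs ++ F).
  have vsK : {subset vs <= K} by move=> v vvs; rewrite mem_undup mem_cat vvs.
  have FK : {subset F <= K} by move=> v vF; rewrite mem_undup mem_cat vF orbT.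
  have uK : uniq K := undup_uniq _.
  rewrite (_ : _ @^-1` rectangle F A = rectangle F (fun v => w @^-1` A v))//.
  rewrite (PE_sub F K)//; last by move=> v; exact: mpre.
  rewrite /E (PE_sub vs K)//; last by move=> v; exact: mpre.
  pose C v := (if v \in F then w @^-1` A v else setT) `&`
              (if v \in vs then u @^-1` J v else setT).
  transitivity (P (rectangle K C)).
    congr (P _); apply/seteqP; split => y /=.
      by move=> [hJ hA] v _; split; case: ifPn => // h; [exact: hA|exact: hJ].
    by move=> h; split => v hv; [have := h v (vsK v hv)|have := h v (FK v hv)];
      rewrite /C hv => -[].
  have mC v : measurable (C v).
    by apply: measurableI; case: ifP => // _; exact: mpre.
  rewrite PE// -big_split/=; apply: eq_bigr => v _; rewrite muleC.
  pose A' := if v \in F then A v else setT.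
  pose J' := if v \in vs then J v else setT.
  have -> : C v = w @^-1` A' `&` u @^-1` J'.
    by rewrite /C /A' /J'; congr (_ `&` _); case: ifP.
  have T1 : unit_law [set: R] = 1%E := probability_setT _.
  rewrite wu; [|by rewrite /A'; case: ifP|by rewrite /J'; case: ifP].
  rewrite /A' /J'; congr (_ * _)%E; case: ifP => _ //.
    by rewrite wE.
  by rewrite uE.
exists P, w, u; split => //.
pose D (p : V * V) := [set y : process V R | p.1 != p.2 -> w (y p.1) <> w (y p.2)].
have mN a b : measurable [set y : process V R | w (y a) = w (y b)].
  rewrite (_ : [set y | _] = (fun y : process V R => w (y a) == w (y b)) @^-1` [set true]).
    apply: measurable_preimageT => //; exact: measurable_fun_eqr.
  by apply/seteqP; split => y /=; [move=> ->; exact: eqxx|move/eqP].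
have N0 a b : a != b -> P [set y : process V R | w (y a) = w (y b)] = 0%E.
  (* given the cell of a grid of mesh 1 / n.+1 containing one priority, the other
     falls into the same cell with probability at most 1 / n.+1 *)
  move=> ab; apply/eqP; rewrite eq_le measure_ge0 andbT.
  apply/lee_addgt0Pr => eps eps0; rewrite add0e.
  have [n neps] : exists n : nat, n.+1%:R^-1 < eps.
    exists (Num.truncn eps^-1); rewrite invf_plt ?posrE//.
    exact: truncnS_gt.
  apply: (@le_trans _ _ ((n.+1%:R^-1)%:E)); last by rewrite lee_fin ltW.
  rewrite -[leRHS]mule1 -[X in (_ * X)%E](probability_setT P).
  pose g (y : process V R) := Num.floor (n.+1%:R * w (y a)).
  have mfl k : measurable (w @^-1` [set t : R | Num.floor (n.+1%:R * t) = k]).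
    by apply: mpre => //; exact: measurable_floor_fiber.
  have mg k : measurable [set y | g y = k].
    exact: (@measurable_coord V _ R a _ (mfl k)).
  apply: (@le_measure_fibers R int _ _ _ _ _ P P _ _ g g) => [|k|k|k].
  - exact: countableP.
  - exact: measurableI.
  - by rewrite setTI.
  rewrite setTI.
  pose A := w @^-1` [set t : R | Num.floor (n.+1%:R * t) = k].
  have Pa : P [set y | g y = k] = unit_law A.
    have := PE [:: a] (fun=> A) isT (fun=> mfl k).
    rewrite big_cons big_nil mule1 => <-; congr (P _); apply/seteqP; split => y /=.
      by move=> Ay d; rewrite inE => /eqP ->.
    by apply; rewrite inE.
  have Pab : P (rectangle [:: a; b] (fun=> A)) = (unit_law A * unit_law A)%E.
    have uab : uniq [:: a; b] by rewrite /= inE ab.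
    by rewrite (PE [:: a; b] (fun=> A) uab (fun=> mfl k)) !big_cons big_nil mule1.
  apply: (@le_trans _ _ (P (rectangle [:: a; b] (fun=> A)))).
    apply: le_measure; rewrite ?inE//; [exact: measurableI|by apply:
        measurable_rectangle => v; exact: mfl|].
    move=> y [wab gk] v; rewrite !inE => /orP[/eqP ->|/eqP ->]//.
    by rewrite /A /= -wab.
  rewrite Pab /= Pa lee_wpmul2r// /A wE; last exact: measurable_floor_fiber.
  exact: unit_law_floor.
have mD p : measurable (D p).
  rewrite /D; case: (eqVneq p.1 p.2) => [_|_].
    by rewrite (_ : [set y | _] = setT)//; apply/seteqP; split.
  rewrite (_ : [set y | _] = ~` [set y : process V R | w (y p.1) = w (y p.2)]).
    exact: measurableC.
  by apply/seteqP; split => y /=; [exact|move=> h _].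
have D1 p : P (D p) = 1%E.
  rewrite /D; case: (eqVneq p.1 p.2) => [_|pp].
    rewrite (_ : [set y | _] = setT) ?probability_setT//; by apply/seteqP; split.
  rewrite (_ : [set y | _] = ~` [set y : process V R | w (y p.1) = w (y p.2)]).
    by rewrite probability_setC// N0// sube0.
  by apply/seteqP; split => y /=; [exact|move=> h _].
have := probability_bigcap mD D1.
rewrite (_ : \bigcap_p _ = [set y : process V R | injective (fun v => w (y v))])//.
apply/seteqP; split => y /=.
  move=> h a b wab; apply/eqP; apply/negP => /negP ab.
  exact: (h (a, b) I ab).
by move=> h [a b] _ /eqP ab /h.
Qed.

End randomness.

(** * The infinite-volume limit *)

Section exhaustion.
Variable V : countType.

Let finite_exhaustion n : finite_set [set v : V | (choice.pickle v < n)%N].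
Proof.
apply: (@finite_preimage _ _ [set k | (k < n)%N] choice.pickle).
  by move=> a b _ _; exact: (pcan_inj choice.pickleK).
exact: finite_II.
Qed.

(** A sequence cofinal among the finite sets, so that limits along finite volumes can be computed
    along the integers. *)
Definition exhaustion (n : nat) : {fset V} :=
  fset_set [set v : V | (choice.pickle v < n)%N].

Lemma mem_exhaustion v n : (v \in exhaustion n) = (choice.pickle v < n)%N.
Proof. by rewrite in_fset_set//; apply/idP/idP; rewrite inE. Qed.

Lemma exhaustion_subset m n : (m <= n)%N -> (exhaustion m `<=` exhaustion n)%fset.
Proof.
by move=> mn; apply/fsubsetP => v; rewrite !mem_exhaustion => /leq_trans; apply.
Qed.

Lemma subset_exhaustion (A : {fset V}) : exists n, (A `<=` exhaustion n)%fset.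
Proof.
exists (\max_(v <- A) (choice.pickle v)).+1; apply/fsubsetP => v vA.
by rewrite mem_exhaustion ltnS; exact: (leq_bigmax_seq (F := choice.pickle)).
Qed.

Lemma cvg_exhaustion : (fun n => [set` exhaustion n]) @ \oo --> @finite_sets_up V.
Proof.
move=> Q [A0 fA0 AQ]; have [n An] := subset_exhaustion (fset_set A0).
exists n => // m /= nm; apply: AQ; first exact: finite_fset.
move=> v A0v /=; apply: (fsubsetP (exhaustion_subset nm)).
by apply: (fsubsetP An); rewrite in_fset_set// inE.
Qed.

End exhaustion.

(** * Weak limits tested on rectangles *)

Section weak_limit.
Variables (R : realType) (V : countType) (disp : Order.disp_t) (S : tOrderType disp).
Notation Omega := (config V S).

Notation discrete_product := (prod_topology (fun _ : V => discrete_topology S)).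

Lemma near_eq_on (F : seq V) (w : discrete_product) :
  nbhs w [set w' : discrete_product | forall v, v \in F -> w' v = w v].
Proof.
elim: F => [|v F IH]; first exact: (@filterE _ _ (nbhs_filter w)).
have nv : nbhs w [set w' : discrete_product | w' v = w v].
  exact: (@proj_continuous V (fun=> discrete_topology S) v w _
    (discrete_set1 (w v : discrete_topology S))).
apply: (@filterS2 _ _ (nbhs_filter w) _ _ _ _ nv IH) => w' wv wF a.
by rewrite inE => /orP[/eqP ->//|]; exact: wF.
Qed.

Lemma locally_constant_continuous (T : topologicalType) (f : T -> R) :
  (forall w, \forall w' \near w, f w' = f w) -> continuous f.
Proof. by move=> h w; apply: cvg_near_cst; exact: h. Qed.

(** A rectangle depends on finitely many discrete coordinates, so its indicator is locally constant
    and is an admissible test function for [weak_limit]. *)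
Lemma rectangle_continuous (F : seq V) (A : V -> set S) :
  continuous ((\1_(rectangle F A) : Omega -> R) : discrete_product -> R).
Proof.
apply: (@locally_constant_continuous discrete_product (\1_(rectangle F A))) => w.
apply: (@filterS _ _ (nbhs_filter w) _ _ _ (near_eq_on F w)) => w' ww'.
rewrite !indicE; congr (nat_of_bool _)%:R.
by apply/idP/idP; rewrite !inE => h v vF; have := h v vF; rewrite ww'.
Qed.

Lemma weak_limit_rectangle (eta : Omega) (rho : spec_family R V S)
    (mu : probability Omega R) (F : seq V) (A : V -> set S) :
  weak_limit eta rho mu ->
  (fun B => rho B eta (rectangle F A)) @ @finite_sets_up V --> mu (rectangle F A).
Proof.
move=> h; have mA : measurable (rectangle F A : set Omega).
  exact: (@measurable_rectangle V _ (spin S)).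
have := h (\1_(rectangle F A)) (@rectangle_continuous F A) _.
rewrite integral_indic// setIT => H; have {}H := H (ex_intro _ 1 _).
rewrite (_ : (fun B => _) = (fun B => (\int[rho B eta]_w (\1_(rectangle F A) w)%:E)%E)).
  by apply: H => w; rewrite indicE; case: (_ \in _); rewrite ?normr1 ?normr0.
by apply/funext => B; rewrite integral_indic// setIT.
Qed.

Lemma weak_limit_coord (eta : Omega) (rho : spec_family R V S)
    (mu : probability Omega R) (v : V) (A : set S) :
  weak_limit eta rho mu ->
  (fun B => rho B eta [set w : Omega | A (w v)]) @ @finite_sets_up V -->
    mu [set w : Omega | A (w v)].
Proof.
move=> /(@weak_limit_rectangle _ _ _ [:: v] (fun=> A)).
rewrite (_ : rectangle _ _ = [set w : Omega | A (w v)])//.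
apply/seteqP; split => w /=; first by apply; rewrite inE.
by move=> Aw a; rewrite inE => /eqP ->.
Qed.

End weak_limit.

(** * Eventual values and their law *)

Section infinite_volume.
Variables (R : realType) (V : countType) (disp : Order.disp_t) (S : tOrderType disp).
Notation Omega := (config V S).
Notation top := (top_config S : Omega).
Hypothesis S_countable : countable [set: S].
Variables (dOm : measure_display) (Om : measurableType dOm) (P : probability Om R).
Variables (z x : Om -> V -> R).
Hypothesis mz : measurable_fun [set: Om] (z : Om -> process V R).
Hypothesis mx : forall v, measurable_fun [set: Om] (fun y => x y v).
Hypothesis zx_indep : forall (vs : seq V) (J : V -> set R) (B : set (process V R)),
  uniq vs -> (forall v, measurable (J v)) -> measurable B ->
  P ([set y | B (z y)] `&` [set y | forall v, v \in vs -> J v (x y v)]) =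
  (P [set y | B (z y)] * \prod_(v <- vs) unit_law (J v))%E.
Variable rho : spec_family R V S.

Let uniform v (A : set R) : measurable A -> P [set y | A (x y v)] = unit_law A.
Proof.
move=> mA; have := zx_indep (vs := [:: v]) (J := fun=> A) isT (fun=> mA) measurableT.
rewrite big_cons big_nil mule1 setTI [P _ in RHS]probability_setT mul1e => <-.
congr (P _); apply/seteqP; split => y /=; last by apply; rewrite inE.
by move=> Ay a; rewrite inE => /eqP ->.
Qed.

(** There are countably many triples of a list, a vertex and a boundary condition, and each excludes
    a null set of uniforms. *)
Lemma regular_uniforms_ae (eta : Omega) :
  measurable [set y | regular_uniforms rho eta (x y)] /\
  P [set y | regular_uniforms rho eta (x y)] = 1%E.
Proof.
have [tau_ [adm all_tau]] := @countable_finite_perturb V _ S eta S_countable.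
pose G (i : seq V * V * nat) := [set y |
  regular (marginal (rho [set` i.1.1] (tau_ i.2)) i.1.2) (x y i.1.2)].
have [mG G1] : (forall i, measurable (G i)) /\ (forall i, P (G i) = 1%E).
  split=> i; have [Q QE] := marginal_probability (rho [set` i.1.1] (tau_ i.2)) i.1.2.
    apply: (measurable_preimageT (mx _)); exact: measurable_regular.
  rewrite /G -QE (@uniform _ (regular Q)); last exact: measurable_regular.
  exact: unit_law_regular.
have := probability_bigcap mG G1.
rewrite (_ : \bigcap_i G i = [set y | regular_uniforms rho eta (x y)])//.
apply/seteqP; split => y h.
  by move=> vs v _ /all_tau[n ->]; exact: (h (vs, v, n)).
by move=> [[vs v] n] _; exact: h.
Qed.

Notation sampled_field A y := (sampled_field rho top A (z y) (x y)).

(** Eventual constancy is required along all finite volumes and not along [exhaustion], which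
    depends on the numbering of [V]; the group permutes the finite volumes, so this notion is
    equivariant. *)
Definition settles (y : Om) v s := exists A0 : {fset V}, forall A : {fset V},
  (A0 `<=` A)%fset -> sampled_field A y v = s.

(** The default is the same at every vertex, so equivariance does not require the values to
    settle. *)
Definition limit_field (y : Om) : Omega := fun v => xget \top%O [set s | settles y v s].

Lemma settles_unique y v s t : settles y v s -> settles y v t -> s = t.
Proof.
move=> [A h] [B h']; rewrite -(h (A `|` B)%fset) ?fsubsetUl// h'//.
exact: fsubsetUr.
Qed.

Lemma limit_field_eq y v s : settles y v s -> limit_field y v = s.
Proof. by move=> ys; apply: xget_unique => // t /settles_unique; apply. Qed.

Hypothesis spec : is_specification (finite_perturb top) rho.
Hypothesis mono : monotone_spec (finite_perturb top) rho.

Let mfield (A : {fset V}) v (X : set S) : measurable [set y | X (sampled_field A y v)].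
Proof.
apply: (measurable_sampled_field S_countable mz mx rho top A (B := [set w : Omega | X (w v)])).
exact: measurable_config_coord.
Qed.

Lemma measurable_settles v s : measurable [set y | settles y v s].
Proof.
rewrite (_ : [set y | _] = \bigcup_(A0 : {fset V}) \bigcap_(A : {fset V})
    [set y | (A0 `<=` A)%fset -> sampled_field A y v = s]); last first.
  apply/seteqP; split => y.
    by move=> [A0 h]; exists A0 => // A _; exact: h.
  by move=> [A0 _ h]; exists A0 => A; exact: h.
apply: countable_union_measurable => [|A0]; first exact: countableP.
rewrite -[X in measurable X]setCK setC_bigcap; apply: measurableC.
apply: countable_union_measurable => [|A]; first exact: countableP.
apply: measurableC; case: (boolP (A0 `<=` A)%fset) => AA.
  rewrite (_ : [set y | _] = [set y | sampled_field A y v = s]).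
    exact: (mfield A v [set s]).
  by apply/seteqP; split => y /=; [exact|].
by rewrite (_ : [set y | _] = setT)//; apply/seteqP; split.
Qed.

Lemma measurable_limit_field_coord v (X : set S) :
  measurable [set y | X (limit_field y v)].
Proof.
pose N := ~` \bigcup_s [set y | settles y v s].
have mN : measurable N.
  apply: measurableC; apply: countable_union_measurable => // s.
  exact: measurable_settles.
have NE y : N y -> limit_field y v = \top%O.
  by move=> Ny; apply: xgetPN => s ys; apply: Ny; exists s.
rewrite (_ : [set y | _] = (\bigcup_s ([set y | settles y v s] `&` [set _ | X s])) `|`
    (N `&` [set _ | X \top%O])); last first.
  apply/seteqP; split => y /=.
    move=> Xy; have [[s _ ys]|Ny] := pselect ((\bigcup_s [set y | settles y v s]) y).
      by left; exists s => //; split => //=; rewrite -(limit_field_eq ys).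
    by right; split => //=; rewrite -(NE y Ny).
  move=> [[s _ [/= ys Xs]]|[Ny XT]]; first by rewrite (limit_field_eq ys).
  by rewrite NE.
have mcst (Q : Prop) : measurable [set _ : Om | Q].
  have [q|nq] := pselect Q.
    by rewrite (_ : [set _ | _] = setT)//; apply/seteqP; split.
  by rewrite (_ : [set _ | _] = set0)//; apply/seteqP; split.
apply: measurableU; last exact: measurableI.
apply: countable_union_measurable => // s; apply: measurableI => //.
exact: measurable_settles.
Qed.

Lemma measurable_limit_field : measurable_fun [set: Om] limit_field.
Proof.
apply: (@measurable_fun_process V _ (spin S)) => v _ X _; rewrite setTI.
exact: measurable_limit_field_coord.
Qed.

Variable mu : probability Omega R.
Hypothesis mu_lim : weak_limit top rho mu.

Let M := [set y | regular_uniforms rho top (x y)].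

Let mM : measurable M. Proof. by have [] := regular_uniforms_ae top. Qed.

Let PM : P M = 1%E. Proof. by have [] := regular_uniforms_ae top. Qed.

Let field_decr (A A' : {fset V}) y v : M y -> (A `<=` A')%fset ->
  (sampled_field A' y v <= sampled_field A y v)%O.
Proof. by move=> My AA'; exact: (sampled_field_shrink_top S_countable (z y) spec mono
    My AA' v). Qed.

Let X n y v := sampled_field (exhaustion V n) y v.

Let PX n v (Y : set S) : P ([set y | Y (X n y v)] `&` M) =
  rho [set` exhaustion V n] top [set w : Omega | Y (w v)].
Proof.
rewrite probability_setI_full//; last exact: mfield.
rewrite -(sampled_field_law S_countable mz mx zx_indep spec)//.
exact: measurable_config_coord.
Qed.

Let cvgX (Y : set S) v : P ([set y | Y (X n y v)] `&` M) @[n --> \oo] -->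
  mu [set w : Omega | Y (w v)].
Proof.
rewrite (_ : (fun n => P _) = (fun n => rho [set` exhaustion V n] top [set w : Omega
    | Y (w v)])).
  exact: (cvg_comp _ _ (@cvg_exhaustion V) (@weak_limit_coord _ _ _ _ _ _ _ v Y mu_lim)).
by apply/funext => n; exact: PX.
Qed.

(* On M, the values at v along the exhaustion decrease to s exactly when they
   reach s or below without ever dropping strictly below s. *)
Lemma settles_prob v s : (mu [set w : Omega | w v = s] <= P [set y | settles y v s])%E.
Proof.
pose a n := [set y | (X n y v <= s)%O] `&` M.
pose b n := [set y | (X n y v < s)%O] `&` M.
have mX n (Y : set S) : measurable ([set y | Y (X n y v)] `&` M).
  by apply: measurableI => //; exact: mfield.
have ma n : measurable (a n) by exact: (mX n [set t | (t <= s)%O]).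
have mb n : measurable (b n) by exact: (mX n [set t | (t < s)%O]).
have mua : measurable (\bigcup_n a n) by exact: bigcup_measurable.
have mub : measurable (\bigcup_n b n) by exact: bigcup_measurable.
have Xle m n y : M y -> (m <= n)%N -> (X n y v <= X m y v)%O.
  by move=> My mn; apply: field_decr => //; exact: exhaustion_subset.
have incr (Y : nat -> set Om) : (forall m n, (m <= n)%N -> Y m `<=` Y n) ->
    {homo Y : m n / (m <= n)%N >-> (m <= n)%O}.
  by move=> h m n mn; apply/subsetPset; exact: h.
have ca : P (a n) @[n --> \oo] --> P (\bigcup_n a n).
  apply: nondecreasing_cvg_mu => //; apply: incr => m n mn y [ym My]; split => //=.
  exact: le_trans (Xle _ _ _ My mn) ym.
have cb : P (b n) @[n --> \oo] --> P (\bigcup_n b n).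
  apply: nondecreasing_cvg_mu => //; apply: incr => m n mn y [ym My]; split => //=.
  exact: le_lt_trans (Xle _ _ _ My mn) ym.
(* The event [a n] is [b n] together with {X n = s}, whose probability tends to the mass of [s]
   under the limit. *)
have cab : P (a n) @[n --> \oo] --> (P (\bigcup_n b n) + mu [set w : Omega | w v = s])%E.
  rewrite (_ : (fun n => P (a n)) =
    (fun n => P (b n) + P ([set y | X n y v = s] `&` M))%E); last first.
    apply/funext => n; rewrite -measureU//; last 2 first.
    - exact: (mX n [set s]).
    - by apply/seteqP; split => // y [[/= ys _] [/= yE _]]; move: ys; rewrite yE ltxx.
    congr (P _); apply/seteqP; split => y.
      by move=> [/=]; rewrite le_eqVlt => /orP[/eqP|] ? ?; [right|left].
    by move=> [[/= /ltW ? ?]|[/= Xs ?]]; split => //=; rewrite Xs.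
  apply: cvgeD => //; last exact: (@cvgX [set s] v).
  by rewrite fin_num_adde_defl// fin_num_measure//; exact: (measurable_config_coord v [set s]).
have ab : P (\bigcup_n a n) = (P (\bigcup_n b n) + mu [set w : Omega | w v = s])%E.
  exact: (cvg_unique _ ca cab).
have ms := measurable_settles v s.
have : (P (\bigcup_n a n) <= P (\bigcup_n b n) + P [set y | settles y v s])%E.
  apply: le_trans (measureU2 _ mub ms); apply: le_measure; rewrite ?inE//.
    exact: measurableU.
  move=> y [n _ [yn My]].
  have [yb|nyb] := pselect ((\bigcup_n b n) y); [by left|right].
  exists (exhaustion V n) => A nA; apply: le_anti.
  rewrite (le_trans (field_decr v My nA) yn)/=.
  (* An arbitrary volume [A] lies in some [exhaustion V m], where the value has not dropped below
     [s]; monotonicity passes this on to [A]. *)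
  have [m Am] := subset_exhaustion A.
  apply: le_trans (field_decr v My Am); rewrite leNgt; apply/negP => ms'.
  by apply: nyb; exists m.
by rewrite ab leeD2lE// fin_num_measure.
Qed.

Definition settled : set Om := \bigcap_v \bigcup_s [set y | settles y v s].

(** This is where total mass one matters: the masses of the one-vertex marginal of [mu] add up to 1,
    and by [settles_prob] they leave no probability for escaping values. *)
Lemma settled_ae : measurable settled /\ P settled = 1%E.
Proof.
have mU v : measurable (\bigcup_s [set y | settles y v s]).
  by apply: countable_union_measurable => // s; exact: measurable_settles.
apply: probability_bigcap => // v.
apply/eqP; rewrite eq_le probability_le1//=.
rewrite -(probability_setT mu) -[mu setT]mul1e.
apply: (@ge_measure_fibers R S S_countable _ _ _ _ P mu _ _
  (fun y => limit_field y v) (fun w => w v)) => // [s|s|s].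
- by apply: measurableI => //; exact: (measurable_limit_field_coord v [set s]).
- by rewrite setTI; exact: (measurable_config_coord v [set s]).
rewrite mul1e setTI; apply: le_trans (settles_prob v s) _.
apply: le_measure; rewrite ?inE//; first exact: measurable_settles.
  by apply: measurableI => //; exact: (measurable_limit_field_coord v [set s]).
by move=> y ys; split; [exists s|exact: limit_field_eq].
Qed.

Lemma settled_settles y v : settled y -> settles y v (limit_field y v).
Proof. by move=> /(_ v I)[s _ ys]; rewrite (limit_field_eq ys). Qed.

(** On [G n] the sample agrees with the limit on [F] in every volume containing [exhaustion V n].
    Since the probability of [G n] tends to 1, the finite-volume probabilities of a rectangle
    converge to that for the limit field; weak convergence sends them to [mu] as well. *)
Lemma limit_field_law (B : set Omega) : measurable B ->
  P (limit_field @^-1` B) = mu B.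
Proof.
have [Q QE] := pushforward_probability P measurable_limit_field.
move=> mB; rewrite -QE; move: B mB.
apply: (process_measure_unique (m1 := Q) (m2 := mu)).
  by rewrite [X in (X < _)%E](probability_setT Q) ltry.
move=> F A mA; set C := rectangle F A.
have mC : measurable (C : set Omega) by exact: (@measurable_rectangle V _ (spin S)).
rewrite /= QE; set L := limit_field @^-1` C.
have mL : measurable L by exact: (measurable_preimageT measurable_limit_field).
pose G n := [set y | forall A : {fset V}, (exhaustion V n `<=` A)%fset ->
  forall v, v \in F -> sampled_field A y v = limit_field y v].
have mE (B : {fset V}) v : measurable [set y | sampled_field B y v = limit_field y v].
  rewrite (_ : [set y | _] = \bigcup_s ([set y | sampled_field B y v = s] `&`
    [set y | limit_field y v = s])); last first.
    by apply/seteqP; split => y /=; [move=> ?; exists (sampled_field B y v)|move=> [s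
        _ [/= -> ->]]].
  apply: countable_union_measurable => // s; apply: measurableI.
    exact: (mfield B v [set s]).
  exact: (measurable_limit_field_coord v [set s]).
have mG n : measurable (G n).
  rewrite (_ : G n = \bigcap_(B : {fset V}) \bigcap_(v : V)
     [set y | (exhaustion V n `<=` B)%fset -> v \in F -> sampled_field B y v =
         limit_field y v]); last first.
    apply/seteqP; split => y; first by move=> h B _ v _ /= nB; exact: h.
    by move=> h B nB v vF; exact: (h B I v I nB vF).
  rewrite -[X in measurable X]setCK setC_bigcap; apply: measurableC.
  apply: countable_union_measurable => [|B]; first exact: countableP.
  rewrite setC_bigcap; apply: countable_union_measurable => [|v]; first exact: countableP.
  apply: measurableC; case: (boolP (exhaustion V n `<=` B)%fset) => nB; last first.
    by rewrite (_ : [set y | _] = setT)//; apply/seteqP; split.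
  case: (boolP (v \in F)) => vF; last first.
    by rewrite (_ : [set y | _] = setT)//; apply/seteqP; split.
  rewrite (_ : [set y | _] = [set y | sampled_field B y v = limit_field y v])//.
  by apply/seteqP; split => y /=; [exact|].
have Gincr : {homo G : m n / (m <= n)%N >-> (m <= n)%O}.
  move=> m n mn; apply/subsetPset => y h B nB; apply: h.
  exact: fsubset_trans (exhaustion_subset V mn) nB.
have mGU : measurable (\bigcup_n G n) by exact: bigcup_measurable.
have [mS S1] := settled_ae.
have GU : P (\bigcup_n G n) = 1%E.
  apply/eqP; rewrite eq_le probability_le1//= -S1; apply: le_measure; rewrite ?inE//.
  move=> y ys.
  have [A0 hA0] : exists A0 : {fset V}, forall B : {fset V}, (A0 `<=` B)%fset ->
      forall v, v \in F -> sampled_field B y v = limit_field y v.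
    elim: F {C mC L mL G mG Gincr mGU A mA} => [|v F [A0 IH]]; first by exists fset0.
    have [A1 hA1] := settled_settles v ys.
    exists (A0 `|` A1)%fset => B; rewrite fsubUset => /andP[B0 B1] a.
    by rewrite inE => /orP[/eqP ->|aF]; [exact: hA1|exact: IH].
  have [n An] := subset_exhaustion A0.
  by exists n => // B nB; apply: hA0; exact: fsubset_trans An nB.
pose W n := [set y | C (sampled_field (exhaustion V n) y)].
have mW n : measurable (W n) by exact: (measurable_sampled_field S_countable mz mx).
have WG n : W n `&` G n = L `&` G n.
  apply/seteqP; split => y [h yG]; split => // v vF.
    by rewrite -(yG _ (fsubset_refl _) v vF); exact: h.
  by rewrite (yG _ (fsubset_refl _) v vF); exact: h.
have cLG : P (L `&` G n) @[n --> \oo] --> P L.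
  rewrite -[X in _ --> P X]setIT.
  have -> : P (L `&` setT) = P (\bigcup_n (L `&` G n)).
    by rewrite setIT -setI_bigcupr probability_setI_full.
  apply: nondecreasing_cvg_mu => [n||m n mn].
  - exact: measurableI.
  - by rewrite -setI_bigcupr; exact: measurableI.
  - by have /subsetPset Gmn := Gincr _ _ mn; apply/subsetPset; exact: setIS.
have cG0 : P (~` G n) @[n --> \oo] --> 0%E.
  rewrite (_ : (fun n => P _) = (fun n => 1 - P (G n))%E); last first.
    by apply/funext => n; rewrite probability_setC.
  rewrite -[X in _ --> X](subee (x := 1%E))//; apply: cvgeB => //; first exact: cvg_cst.
  by rewrite -GU; exact: nondecreasing_cvg_mu.
have cWG0 : P (W n `&` ~` G n) @[n --> \oo] --> 0%E.
  apply: (squeeze_cvge _ (cvg_cst 0%E) cG0); near=> n; rewrite measure_ge0/=.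
  have mGc : measurable (~` G n) by exact: measurableC.
  by apply: le_measure; rewrite ?inE//; exact: measurableI.
have cW : P (W n) @[n --> \oo] --> P L.
  rewrite (_ : (fun n => P (W n)) = (fun n => P (L `&` G n) + P (W n `&` ~` G n))%E).
    rewrite -[X in _ --> X]adde0; apply: cvgeD => //.
    by rewrite fin_num_adde_defl.
  apply/funext => n; have mGc : measurable (~` G n) by exact: measurableC.
  rewrite -WG -measureU//; [|exact: measurableI|exact: measurableI|].
    by rewrite -setIUr setUv setIT.
  by apply/seteqP; split => // y [[_ Gy] [_]].
have cW' : P (W n) @[n --> \oo] --> mu C.
  rewrite (_ : (fun n => P (W n)) = (fun n => rho [set` exhaustion V n] top C)).
    exact: (cvg_comp _ _ (@cvg_exhaustion V) (@weak_limit_rectangle _ _ _ _ _ _ _ F A mu_lim)).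
  by apply/funext => n; exact: (sampled_field_law S_countable mz mx zx_indep spec).
exact: (cvg_unique _ cW cW').
Unshelve. all: by end_near. Qed.

End infinite_volume.

(** * The coding and its radius *)

Lemma standard_borel_real (R : realType) : standard_borel R R.
Proof.
exists (R : completePseudoMetricType R), id; split.
- exact: norm_hausdorff.
- exists (range (@ratr R)); last exact: dense_rat.
  by apply: sub_countable (card_image_le _ _) _.
- by exists id.
move=> A; rewrite image_id; split.
  rewrite (_ : measurable A = (@ocitv R).-sigma.-measurable A)//.
  rewrite RGenOpens.measurableE; apply: smallest_sub.
    exact: smallest_sigma_algebra.
  by move=> _ [a [b ->]]; apply: sub_sigma_algebra; exact: interval_open.
apply: smallest_sub; first exact: sigma_algebra_measurable.
exact: open_measurable.
Qed.

Section graph_balls.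
Variables (R : realType) (V : countType) (e : rel V).

Lemma gball_path (v u : V) (r : nat) :
  gball R e v r u <-> exists p, [/\ path e v p, last v p = u & (size p <= r)%N].
Proof.
split; last first.
  move=> [p [ep pu pr]]; apply: (@le_trans _ _ ((size p)%:R%:E)).
    by apply: ereal_inf_lbound; exists p.
  by rewrite lee_fin ler_nat.
move=> vr; apply: contrapT => nop; move: vr; rewrite /gball /= leNgt => /negP; apply.
(* Path lengths are integers: if none is at most [r], the infimum is at least [r + 1], which gives
   the strict inequality. *)
apply: (@lt_le_trans _ _ (r.+1%:R%:E)); first by rewrite lte_fin ltr_nat.
apply: le_ereal_inf_tmp => _ [p [ep pu] <-]; rewrite lee_fin ler_nat ltnNge.
by apply/negP => pr; apply: nop; exists p.
Qed.

Lemma gball_finite (v : V) (r : nat) : locally_finite e -> finite_set (gball R e v r).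
Proof.
move=> lf; pose N r := [set u | exists p, [/\ path e v p, last v p = u & (size p <= r)%N]].
rewrite (_ : gball R e v r = N r); last first.
  by apply/seteqP; split => u /gball_path.
elim: r => [|r IH].
  apply: (@sub_finite_set _ _ [set v]); last exact: finite_set1.
  by move=> u [p [_ <-]]; rewrite leqn0 size_eq0 => /eqP ->.
apply: (@sub_finite_set _ _ (N r `|` \bigcup_(a in N r) [set u | e a u])); last first.
  by rewrite finite_setU; split => //; apply: bigcup_finite.
move=> u [p [ep pu pr]]; case/lastP: p ep pu pr => [_ <- _|p a].
  by left; exists [::].
rewrite rcons_path last_rcons size_rcons => /andP[ep ea] <- pr; right.
by exists (last v p) => //; exists p.
Qed.

(** Connectedness makes the balls around [v] swallow every finite set, so finite-volume limits may
    be taken along balls. *)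
Lemma cvg_gball (v : V) : locally_finite e -> connected_graph e ->
  (fun r => gball R e v r) @ \oo --> @finite_sets_up V.
Proof.
move=> lf conn Q [A0 fA0 AQ].
have [n hn] : exists n, forall r, (n <= r)%N -> A0 `<=` gball R e v r.
  have /choice[p pP] := conn v.
  exists (\max_(u <- fset_set A0) size (p u)) => r nr u A0u; apply/gball_path.
  have [? ?] := pP u; exists (p u); split => //; apply: leq_trans nr.
  by apply: (leq_bigmax_seq (F := fun u => size (p u))) => //; rewrite in_fset_set// inE.
by exists n => // r /= nr; apply: AQ; [exact: gball_finite|exact: hn].
Qed.

End graph_balls.

(** * Equivariance of the limit *)

Section coding.
Variables (R : realType) (V : countType) (disp : Order.disp_t) (S : tOrderType disp).
Variables (Gamma : groupType) (act : Gamma -> V -> V).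
Hypothesis actP : is_left_action act.
Variable rho : spec_family R V S.
Hypothesis rho_inv : invariant_spec act (finite_perturb (top_config S)) rho.
Variables (w u : R -> R).

Notation prio y := (fun v : V => w (y v)).
Notation unif y := (fun v : V => u (y v)).
Notation phi := (limit_field (fun y : process V R => prio y) (fun y => unif y) rho).

Let act_V (T : Type) (g : Gamma) (y : V -> T) : act_config act g^-1%g (act_config act g y) = y.
Proof.
by apply/funext => v; rewrite /act_config invgK -actP.2 mulVg actP.1.
Qed.

Let imfset_actV (g : Gamma) (A : {fset V}) : (act g @` (act g^-1%g @` A))%fset = A.
Proof.
apply/fsetP => v; apply/imfsetP/idP => [[_ /imfsetP[a /= aA ->] ->]|vA].
  by rewrite -actP.2 mulgV actP.1.
exists (act g^-1%g v); first by apply/imfsetP; exists v.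
by rewrite -actP.2 mulgV actP.1.
Qed.

(** The volumes containing the image of [A0] under [g] are exactly the images of the volumes
    containing [A0], and without ties the sample is equivariant in each of them. *)
Lemma act_config_settles (g : Gamma) (y : process V R) v s : injective (prio y) ->
  settles (fun y : process V R => prio y) (fun y => unif y) rho y v s ->
  settles (fun y : process V R => prio y) (fun y => unif y) rho (act_config act g y)
      (act g v) s.
Proof.
move=> inj [A0 hA0]; exists (act g @` A0)%fset => A gA.
have := @act_config_sampled_field _ _ _ _ _ _ actP _ _ rho_inv g (act g^-1%g @`
    A)%fset _ (unif y) inj (erefl _).
rewrite imfset_actV => h.
transitivity (act_config act g (sampled_field rho (top_config S) (act g^-1%g @`
    A)%fset (prio y) (unif y)) (act g v)).
  by rewrite -h.
rewrite /act_config -actP.2 mulVg actP.1; apply: hA0.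
apply/fsubsetP => a aA0; apply/imfsetP; exists (act g a).
  by apply: (fsubsetP gA); apply/imfsetP; exists a.
by rewrite -actP.2 mulVg actP.1.
Qed.

Lemma injective_act_config (g : Gamma) (y : process V R) :
  injective (prio y) -> injective (prio (act_config act g y)).
Proof.
move=> inj a b /inj ab.
by rewrite -[a](actP.1) -[b](actP.1) -(mulgV g) !actP.2 ab.
Qed.

Lemma limit_field_equivariant (g : Gamma) (y : process V R) : injective (prio y) ->
  phi (act_config act g y) = act_config act g (phi y).
Proof.
move=> inj; apply/funext => v; rewrite /limit_field {2}/act_config.
congr (xget _ _); apply/seteqP; split => s /= h.
  have := @act_config_settles g^-1%g _ _ _ (@injective_act_config g _ inj) h.
  by rewrite act_V.
have := @act_config_settles g _ _ _ inj h.
by rewrite -actP.2 mulgV actP.1.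
Qed.

End coding.

(** * Coding radius from the two boundary conditions *)

Section limit_radius.
Variables (R : realType) (V : countType) (disp : Order.disp_t) (S : finTBOrderType disp).
Variables (rho : spec_family R V S) (w u : R -> R).
Notation Omega := (config V S).
Notation top := (top_config S : Omega).
Notation bot := (bot_config S : Omega).
Notation prio y := (fun v : V => w (y v)).
Notation unif y := (fun v : V => u (y v)).
Notation phi := (limit_field (fun y : process V R => prio y) (fun y => unif y) rho).
Hypothesis spec : is_specification (finite_perturb top) rho.
Hypothesis spec' : is_specification (finite_perturb bot) rho.
Hypothesis mono : monotone_updown rho.
Variable P : probability (process V R) R.
Hypothesis mz : measurable_fun setT (fun y : process V R => prio y : process V R).
Hypothesis mx : forall v, measurable_fun setT (fun y : process V R => u (y v)).
Hypothesis zx_indep : forall (vs : seq V) (J : V -> set R) (B : set (process V R)),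
  uniq vs -> (forall v, measurable (J v)) -> measurable B ->
  P ([set y | B (prio y)] `&` [set y | forall v, v \in vs -> J v (u (y v))]) =
  (P [set y | B (prio y)] * \prod_(v <- vs) unit_law (J v))%E.
Variable mu : probability Omega R.
Hypothesis mu_lim : weak_limit top rho mu.

Let S_countable : countable [set: S].
Proof. exact: finite_set_countable. Qed.

Let mono1 : monotone_spec (finite_perturb top) rho.
Proof. by case: mono. Qed.

(** Both the event on which the comparisons hold surely and the full-measure set outside which
    configurations are discarded in the coding radius. *)
Definition coupled : set (process V R) :=
  [set y | regular_uniforms rho top (unif y)] `&`
  [set y | regular_uniforms rho bot (unif y)] `&`
  settled (fun y : process V R => prio y) (fun y => unif y) rho.

Lemma coupled_ae : measurable coupled /\ P coupled = 1%E.
Proof.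
have [m1 P1] := regular_uniforms_ae S_countable mx zx_indep rho top.
have [m2 P2] := regular_uniforms_ae S_countable mx zx_indep rho bot.
have [m3 P3] := settled_ae S_countable mz mx zx_indep spec mono1 mu_lim.
have m12 := measurableI _ _ m1 m2.
split; first exact: measurableI.
by rewrite probability_setI_full// probability_setI_full.
Qed.

Notation upper A y := (sampled_field rho top A (prio y) (unif y)).
Notation lower A y := (sampled_field rho bot A (prio y) (unif y)).

Let lower_le_upper y (A A' : {fset V}) : coupled y -> (A `<=` A')%fset ->
  config_le (lower A y) (upper A' y).
Proof.
move=> [[regT regB] _] AA'; case: mono => _ _ mono3.
by apply: (sampled_field_grow S_countable _ spec mono3) => // v s; exact: le0x.
Qed.

(** The settled value is read in a settling volume enlarged by [A], which can be compared with both
    samples in [A]. *)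
Lemma limit_field_sandwich y (A : {fset V}) v : coupled y ->
  (lower A y v <= phi y v <= upper A y v)%O.
Proof.
move=> cy; have [[regT _] sy] := cy.
have [A0 hA0] := settled_settles v sy.
rewrite -(hA0 (A0 `|` A)%fset (fsubsetUl _ _)); apply/andP; split.
  exact: (lower_le_upper cy (fsubsetUr _ _)).
by have := sampled_field_shrink_top S_countable (prio y) spec mono1 regT (fsubsetUr A0 A) v.
Qed.

Definition uncoupled (A : {fset V}) (v : V) : set (process V R) :=
  [set y | lower A y v <> upper A y v].

Let mlevel eta (A : {fset V}) v (Y : set S) :
  measurable [set y : process V R | Y (sampled_field rho eta A (prio y) (unif y) v)].
Proof.
apply: (measurable_sampled_field S_countable mz mx rho eta A (B := [set o : Omega | Y (o v)])).
exact: measurable_config_coord.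
Qed.

Lemma measurable_uncoupled A v : measurable (uncoupled A v).
Proof.
rewrite (_ : uncoupled A v = ~` \bigcup_s ([set y | lower A y v = s] `&`
    [set y | upper A y v = s])).
  apply: measurableC; apply: countable_union_measurable => // s.
  by apply: measurableI; [exact: (mlevel bot A v [set s])|exact: (mlevel top A v [set s])].
apply/seteqP; split => y /=; first by move=> h [s _ [/= <- /esym]].
by move=> h lu; apply: h; exists (upper A y v).
Qed.

Let tail eta (A : {fset V}) v s := rho [set` A] eta [set o : Omega | (s <= o v)%O].

(** The coupling is monotone, so the event that [s] separates the two samples at [v] has probability
    exactly the difference of the tails at [s]. *)
Lemma uncoupled_prob A v :
  (P (coupled `&` uncoupled A v) <=
   \sum_(s : S | s != \bot%O) (tail top A v s - tail bot A v s))%E.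
Proof.
have [mc Pc] := coupled_ae.
pose above eta (s : S) := [set y : process V R | (s <= sampled_field rho eta A (prio
    y) (unif y) v)%O] `&` coupled.
have ma eta s : measurable (above eta s).
  by apply: measurableI => //; exact: (mlevel eta A v [set t | (s <= t)%O]).
have PT s : P (above top s) = tail top A v s.
  rewrite /above probability_setI_full//; last exact: (mlevel top A v [set t | (s <= t)%O]).
  rewrite /tail -(sampled_field_law S_countable mz mx zx_indep spec)//.
  exact: (measurable_config_coord v [set t | (s <= t)%O]).
have PB s : P (above bot s) = tail bot A v s.
  rewrite /above probability_setI_full//; last exact: (mlevel bot A v [set t | (s <= t)%O]).
  rewrite /tail -(sampled_field_law S_countable mz mx zx_indep spec')//.
  exact: (measurable_config_coord v [set t | (s <= t)%O]).
have above_le s : above bot s `<=` above top s.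
  move=> y [/= sy cy]; split => //=; apply: le_trans sy _.
  exact: (lower_le_upper cy (fsubset_refl A)).
pose D s := above top s `\` above bot s.
have mD s : measurable (D s) by exact: measurableD.
have PD s : P (D s) = (tail top A v s - tail bot A v s)%E.
  rewrite measureD ?ltey_eq ?fin_num_measure//.
  by rewrite (setIidr (above_le s)) /= PT PB.
have union (l : seq S) : (P (\bigcup_(s in [set` l]) D s) <= \sum_(s <- l) P (D s))%E.
  elim: l => [|s l IH].
    by rewrite big_nil (_ : [set` _] = set0) ?bigcup_set0 ?measure0//; apply/seteqP; split.
  have mUl : measurable (\bigcup_(t in [set` l]) D t).
    by apply: fin_bigcup_measurable => //; exact: finite_seq.
  rewrite big_cons (_ : \bigcup_(_ in _) _ = D s `|` \bigcup_(t in [set` l]) D t).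
    apply: le_trans (measureU2 _ _ _) _ => //; exact: leeD2l.
  apply/seteqP; split => y.
    by move=> [t /=]; rewrite inE => /orP[/eqP -> ?|tl Dt]; [left|right; exists t].
  by move=> [Ds|[t tl Dt]]; [exists s|exists t] => //=; rewrite inE ?eqxx// tl orbT.
rewrite -big_filter; under eq_bigr do rewrite -PD.
set l := [seq _ <- _ | _].
have mUl : measurable (\bigcup_(t in [set` l]) D t).
  by apply: fin_bigcup_measurable => //; exact: finite_seq.
apply: le_trans (union l); apply: le_measure; rewrite ?inE//.
  by apply: measurableI => //; exact: measurable_uncoupled.
(* The separating level is the value of the upper sample; it is not [\bot] because the lower sample
   is strictly below it. *)
move=> y [cy yu]; exists (upper A y v).
  rewrite /= mem_filter mem_index_enum andbT; apply/negP => /eqP u0.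
  apply: yu; apply: le_anti; rewrite (lower_le_upper cy (fsubset_refl A))/=.
  by rewrite u0 le0x.
split; first by split => /=.
by move=> [/= ul _]; apply: yu; apply: le_anti; rewrite ul (lower_le_upper cy (fsubset_refl A)).
Qed.

(** Each tail difference compares the marginals on an up-set, hence is at most [tv]; the level
    [\bot] does not occur in the sum. *)
Lemma uncoupled_prob_tv A v :
  (P (coupled `&` uncoupled A v) <=
   ((#|S|%:R - 1) * tv_dist (marginal (rho [set` A] top) v)
                            (marginal (rho [set` A] bot) v))%:E)%E.
Proof.
apply: le_trans (uncoupled_prob A v) _.
set tv := tv_dist _ _.
have fin eta s : tail eta A v s \is a fin_num.
  apply: fin_num_measure; exact: (measurable_config_coord v [set t | (s <= t)%O]).
have le_tv s : (tail top A v s - tail bot A v s <= tv%:E)%E.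
  rewrite -(fineK (fin top s)) -(fineK (fin bot s)) -EFinB lee_fin.
  apply: le_trans (ler_norm _) _; apply: ub_le_sup; last by exists [set t | (s <= t)%O].
  exists 1 => _ [Y _ <-].
  have mY : measurable [set o : Omega | Y (o v)] by exact: measurable_config_coord.
  have bd eta : 0 <= fine (marginal (rho [set` A] eta) v Y) <= 1.
    have [Q <-] := marginal_probability (rho [set` A] eta) v.
    by rewrite fine_ge0//= -lee_fin fineK ?fin_num_measure// probability_le1.
  have := bd top; have := bd bot; rewrite ler_norml; lra.
apply: (@le_trans _ _ (\sum_(s : S | s != \bot%O) tv%:E)%E).
  by apply: lee_sum => s _; exact: le_tv.
rewrite sumEFin lee_fin sumr_const [X in _ *+ X](_ : _ = #|S|.-1); last first.
  by rewrite -(cardC1 (\bot%O : S)); apply: eq_card.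
have S0 : (0 < #|S|)%N by apply/card_gt0P; exists \bot%O.
have -> : #|S|%:R - 1 = (#|S|.-1)%:R :> R by rewrite -{1}(prednK S0) -natr1 addrK.
by rewrite mulr_natl.
Qed.

Variable e : rel V.
Hypothesis e_lf : locally_finite e.

Definition limit_radius := coding_radius_on R e coupled phi.

(** If the two samples in the ball agree at [v], they are unchanged for every [y'] in [coupled] that
    agrees with [y] on the ball, and the sandwich pins [phi] at [v] to the same value. *)
Lemma limit_radius_gt_subset v r :
  [set y | (r%:R%:E < limit_radius v y)%E] `<=`
  ~` coupled `|` (coupled `&` uncoupled (fset_set (gball R e v r)) v).
Proof.
move=> y; rewrite /= ltNge => /negP rad.
have [cy|ncy] := pselect (coupled y); [right|by left].
split => // lu; apply: rad; apply: ereal_inf_lbound; exists r => // y' cy' yy'.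
set B := fset_set _ in lu.
have BE a : a \in B -> y' a = y a.
  by rewrite in_fset_set; [rewrite inE; exact: yy'|exact: gball_finite].
have fE eta : sampled_field rho eta B (prio y') (unif y') = sampled_field rho eta B
    (prio y) (unif y).
  by apply: eq_in_sampled_field => a /BE ->.
have := limit_field_sandwich B v cy; have := limit_field_sandwich B v cy'.
rewrite !fE lu => /le_anti h1 /le_anti h2.
by rewrite -h1 h2.
Qed.

Lemma limit_radius_gt_prob v r :
  (prob_radius_gt P limit_radius v r <=
   P (coupled `&` uncoupled (fset_set (gball R e v r)) v))%E.
Proof.
have [mc Pc] := coupled_ae.
have mu_ := measurable_uncoupled (fset_set (gball R e v r)) v.
have mcu := measurableI _ _ mc mu_.
rewrite /prob_radius_gt; apply: le_trans (le_mu_ext _ (@limit_radius_gt_subset v r)) _.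
rewrite measurable_mu_extE; last by apply: measurableU => //; exact: measurableC.
apply: le_trans (measureU2 _ _ _) _ => //; first exact: measurableC.
have c0 : P (~` coupled) = 0%E by rewrite probability_setC// Pc subee.
by rewrite [X in (X + _)%E]c0 add0e.
Qed.

(** When the two limits coincide, both tails at each level converge to the same number, and there
    are finitely many levels. *)
Lemma uncoupled_gball_cvg (mu' : probability Omega R) v :
  connected_graph e -> weak_limit bot rho mu' ->
  (forall B : set Omega, measurable B -> mu B = mu' B) ->
  P (coupled `&` uncoupled (fset_set (gball R e v r)) v) @[r --> \oo] --> 0%E.
Proof.
move=> conn mu'_lim mu_eq.
have [mc _] := coupled_ae.
have ct s : (tail top (fset_set (gball R e v r)) v s -
    tail bot (fset_set (gball R e v r)) v s)%E @[r --> \oo] --> 0%E.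
  have ms : measurable [set o : Omega | (s <= o v)%O].
    exact: (measurable_config_coord v [set t | (s <= t)%O]).
  have lim eta (nu : probability Omega R) : weak_limit eta rho nu ->
      tail eta (fset_set (gball R e v r)) v s @[r --> \oo] -->
      nu [set o : Omega | (s <= o v)%O].
    move=> nu_lim.
    rewrite (_ : (fun r => tail eta (fset_set (gball R e v r)) v s) =
      (fun r => rho (gball R e v r) eta [set o : Omega | (s <= o v)%O])).
      exact: (cvg_comp _ _ (@cvg_gball R V e v e_lf conn)
        (@weak_limit_coord _ _ _ _ _ _ _ v [set t | (s <= t)%O] nu_lim)).
    by apply/funext => r; rewrite /tail fset_setK//; exact: gball_finite.
  rewrite -[X in _ --> X](subee (x := mu [set o : Omega | (s <= o v)%O])).
    apply: cvgeB; [|exact: lim|rewrite mu_eq//; exact: lim].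
    by rewrite fin_num_adde_defl// fin_numN fin_num_measure.
  by rewrite fin_num_measure.
have cs : (\sum_(s : S | s != \bot%O) (tail top (fset_set (gball R e v r)) v s -
    tail bot (fset_set (gball R e v r)) v s))%E @[r --> \oo] --> 0%E.
  elim: (index_enum S) => [|s l IH].
    rewrite (_ : (fun r => _) = fun=> 0%E); first exact: cvg_cst.
    by apply/funext => r; rewrite big_nil.
  have [s0|s0] := boolP (s != \bot%O).
    rewrite -[X in _ --> X]add0e; apply: cvg_trans (cvgeD _ (ct s) IH) => //.
    by apply: near_eq_cvg; apply: nearW => r; rewrite big_cons s0.
  apply: cvg_trans IH; apply: near_eq_cvg; apply: nearW => r.
  by rewrite big_cons (negbTE s0).
apply: (squeeze_cvge _ (cvg_cst 0%E) cs); near=> r.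
by rewrite measure_ge0/= uncoupled_prob.
Unshelve. all: by end_near. Qed.

(** An infinite radius exceeds every [r], so it forces membership in all the measurable sets [N r],
    whose probabilities tend to 0. *)
Lemma limit_radius_lty_ae (mu' : probability Omega R) v :
  connected_graph e -> weak_limit bot rho mu' ->
  (forall B : set Omega, measurable B -> mu B = mu' B) ->
  {ae P, forall y, (limit_radius v y < +oo)%E}.
Proof.
move=> conn mu'_lim mu_eq.
have [mc Pc] := coupled_ae.
pose N r := ~` coupled `|` (coupled `&` uncoupled (fset_set (gball R e v r)) v).
have mcu r : measurable (coupled `&` uncoupled (fset_set (gball R e v r)) v).
  by apply: measurableI => //; exact: measurable_uncoupled.
have mN r : measurable (N r) by apply: measurableU => //; exact: measurableC.
exists (\bigcap_r N r); split; first exact: bigcapT_measurable.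
  apply/eqP; rewrite eq_le measure_ge0 andbT.
  apply: (cvge_to_ge (@uncoupled_gball_cvg _ v conn mu'_lim mu_eq)).
  apply: nearW => r; apply: (@le_trans _ _ (P (N r))).
    apply: le_measure; rewrite ?inE//; first exact: bigcapT_measurable.
    by move=> y; exact.
  apply: le_trans (measureU2 _ _ _) _ => //; first exact: measurableC.
  have c0 : P (~` coupled) = 0%E by rewrite probability_setC// Pc subee.
  by rewrite [X in (X + _)%E]c0 add0e.
move=> y /= /negP; rewrite -leNgt leye_eq => /eqP rad r _.
by apply: limit_radius_gt_subset; rewrite /= rad ltry.
Qed.

End limit_radius.

(** * Assembly of the codings *)

Lemma limit_field_coding (R : realType) (V : countType) (disp : Order.disp_t)
    (S : tOrderType disp) (Gamma : groupType) (act : Gamma -> V -> V)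
    (rho : spec_family R V S) (P : probability (process V R) R) (w u : R -> R)
    (mu : probability (config V S) R) :
  countable [set: S] -> is_left_action act ->
  is_specification (finite_perturb (top_config S)) rho ->
  monotone_spec (finite_perturb (top_config S)) rho ->
  invariant_spec act (finite_perturb (top_config S)) rho ->
  weak_limit (top_config S) rho mu ->
  measurable_fun setT (fun y : process V R => (fun v => w (y v)) : process V R) ->
  (forall v, measurable_fun setT (fun y : process V R => u (y v))) ->
  (forall (vs : seq V) (J : V -> set R) (B : set (process V R)),
     uniq vs -> (forall v, measurable (J v)) -> measurable B ->
     P ([set y | B (fun v => w (y v))] `&`
        [set y | forall v, v \in vs -> J v (u (y v))]) =
     (P [set y | B (fun v => w (y v))] * \prod_(v <- vs) unit_law (J v))%E) ->
  measurable [set y : process V R | injective (fun v => w (y v))] ->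
  P [set y : process V R | injective (fun v => w (y v))] = 1%E ->
  is_coding act P mu
    (limit_field (fun y : process V R => (fun v => w (y v)))
                 (fun y => (fun v => u (y v))) rho).
Proof.
move=> S_countable actP spec mono rho_inv mu_lim mz mx indep minj inj1; split.
- exact: (measurable_limit_field S_countable mz mx).
- exact: (limit_field_law S_countable mz mx indep spec mono mu_lim).
(* The invariant set of full measure consists of the configurations without ties among the
   priorities. *)
exists [set y : process V R | injective (fun v => w (y v))]; split => //.
  move=> g y; exact: injective_act_config.
by move=> g y; exact: limit_field_equivariant.
Qed.

Lemma is_specification_sub (R : realType) (V : countType) (disp : Order.disp_t)
    (S : tOrderType disp) (adm adm' : set (config V S)) (rho : spec_family R V S) :
  adm' `<=` adm -> is_specification adm rho -> is_specification adm' rho.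
Proof.
move=> sub [h1 h2 h3]; split.
- by move=> A tau fA /sub; exact: h1.
- by move=> A tau tau' fA /sub ? /sub ?; exact: h2.
- by move=> U A tau fA UA /sub; exact: h3.
Qed.

Theorem theorem7 (R : realType) (V : countType) (e : rel V)
    (Gamma : groupType) (act : Gamma -> V -> V) :
  infinite_set [set: V] -> symmetric e -> locally_finite e ->
  is_left_action act -> by_automorphisms e act -> quasi_transitive act ->
  (forall (d : Order.disp_t) (S : tOrderType d) (rho : spec_family R V S),
     countable [set: S] ->
     is_specification (finite_perturb (top_config S)) rho ->
     monotone_spec (finite_perturb (top_config S)) rho ->
     invariant_spec act (finite_perturb (top_config S)) rho ->
     irreducible_spec (top_config S) rho ->
     forall mu_plus : probability (config V S) R,
       weak_limit (top_config S) rho mu_plus ->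
       fiid act mu_plus)
  /\
  (forall (d : Order.disp_t) (S : finTBOrderType d) (rho : spec_family R V S),
     is_specification (adm_updown S) rho ->
     monotone_updown rho ->
     invariant_spec act (adm_updown S) rho ->
     irreducible_updown rho ->
     forall mu_plus : probability (config V S) R,
       weak_limit (top_config S) rho mu_plus ->
       (exists (d' : measure_display) (T : measurableType d')
          (P : probability (process V T) R)
          (phi : process V T -> config V S)
          (rad : V -> process V T -> \bar R),
          [/\ standard_borel R T, iid P, is_coding act P mu_plus phi,
              is_coding_radius e P phi rad
            & forall (v : V) (r : nat),
                (prob_radius_gt P rad v r <=
                 ((#|S|%:R - 1) *
                  tv_dist
                    (marginal (rho (gball R e v r) (top_config S)) v)
                    (marginal (rho (gball R e v r) (bot_config S)) v))%:E)%E])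
       /\
       (forall mu_minus : probability (config V S) R,
          weak_limit (bot_config S) rho mu_minus ->
          (forall B : set (config V S),
             measurable B -> mu_plus B = mu_minus B) ->
          connected_graph e ->
          ffiid act e mu_plus)).
Proof.
move=> _ _ e_lf actP _ _.
(* The source and the splitting maps depend on [V] only, so one choice serves all spin spaces and
   specifications in both parts. *)
have [P [w [u [iidP mz mx indep [minj inj1]]]]] := iid_priorities_uniforms R V.
split.
  move=> d S rho S_countable spec mono rho_inv _ mu mu_lim.
  exists _, R, P; eexists; split; [exact: standard_borel_real|exact: iidP|].
  exact: (limit_field_coding S_countable actP spec mono rho_inv mu_lim mz mx indep minj inj1).
move=> d S rho spec mono rho_inv _ mu mu_lim.
have specT : is_specification (finite_perturb (top_config S)) rho.
  by apply: is_specification_sub spec => tau; left.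
have specB : is_specification (finite_perturb (bot_config S)) rho.
  by apply: is_specification_sub spec => tau; right.
have monoT : monotone_spec (finite_perturb (top_config S)) rho by case: mono.
have invT : invariant_spec act (finite_perturb (top_config S)) rho.
  by move=> g A tau fA htau; apply: rho_inv => //; left.
have S_countable : countable [set: S] by exact: finite_set_countable.
have coding := limit_field_coding S_countable actP specT monoT invT mu_lim mz mx
    indep minj inj1.
have [mc Pc] := coupled_ae specT mono mz mx indep mu_lim.
have radP : is_coding_radius e P (limit_field (fun y : process V R => (fun v => w (y v)))
    (fun y => (fun v => u (y v))) rho) (limit_radius rho w u e).
  by exists (coupled rho w u).
split.
  exists _, R, P; do 2 eexists; split;
    [exact: standard_borel_real|exact: iidP|exact: coding|exact: radP|] => v r.
  apply: le_trans (limit_radius_gt_prob specT mono mz mx indep mu_lim e_lf v r) _.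
  rewrite -[gball R e v r in leRHS]fset_setK; last exact: gball_finite.
  exact: (uncoupled_prob_tv specT specB mono mz mx indep mu_lim).
move=> mu' mu'_lim mu_eq conn.
exists _, R, P; do 2 eexists; split;
  [exact: standard_borel_real|exact: iidP|exact: coding|exact: radP|] => v.
exact: (@limit_radius_lty_ae R V _ S rho w u specT specB mono P mz mx indep mu mu_lim
  e e_lf mu' v conn 
  mu'_lim mu_eq).
Qed.
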